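(* Let $\gamma_{\min}>1$ and $\gamma>\gamma_{\min}$. Then for any $R\ge2$ there is a sequence $(\varepsilon_n)$ with $\varepsilon_n\to0$ such that for all $n$, $$\sup_{f\in\mathcal{F}_n(R)}\frac{\mathbb{E}_f\big(\|\tilde f^H_{n,\gamma}-f\|_2^2\big)}{\sum_{\lambda\in\Gamma_n}\min(\beta_\lambda^2,V_{\lambda,n})+\frac1n}\ge 2(\sqrt\gamma-\sqrt{\gamma_{\min}})^2\ln n\,(1+\varepsilon_n),$$ where $\mathbb{E}_f$ denotes expectation when $N$ is a Poisson process on $\mathbb{R}$ with intensity $nf$ with respect to Lebesgue measure, and $\beta_\lambda,V_{\lambda,n}$ are computed from $f$.
   Context: Haar basis: $\phi=1_{[0,1]}$, $\psi=1_{[0,1/2]}-1_{(1/2,1]}$, $\phi_k(x)=\phi(x-k)$, $\psi_{j,k}(x)=2^{j/2}\psi(2^jx-k)$ ($j\ge0$, $k\in\mathbb{Z}$). $\Lambda=\{(j,k):j\ge-1,k\in\mathbb{Z}\}$; $\varphi_\lambda=\phi_k$ if $\lambda=(-1,k)$ and $\varphi_\lambda=\psi_{j,k}$ if $\lambda=(j,k)$, $j\ge0$. For $f\in L_2$, $\beta_\lambda=\int\varphi_\lambda f$; $F_\lambda=\int_{\{\varphi_\lambda\ne0\}}f$. $\mathcal{F}_n(R)$ ($n\ge2$, $R>0$): nonnegative $f$ with $\|f\|_1,\|f\|_2,\|f\|_\infty\le R$ and $F_\lambda\ge\frac{(\ln n)(\ln\ln n)}{n}1_{\{\beta_\lambda\ne0\}}$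 for all $\lambda\in\Lambda$. Define $\hat\beta_\lambda=\frac1n\sum_{T\in N}\varphi_\lambda(T)$, $\hat V_{\lambda,n}=\frac1{n^2}\sum_{T\in N}\varphi_\lambda^2(T)$, $V_{\lambda,n}=\frac1n\int\varphi_\lambda^2 f$, $$\tilde V_{\lambda,n}=\hat V_{\lambda,n}+\sqrt{2\gamma\ln n\,\hat V_{\lambda,n}\frac{\|\varphi_\lambda\|_\infty^2}{n^2}}+3\gamma\ln n\frac{\|\varphi_\lambda\|_\infty^2}{n^2},\qquad \eta_{\lambda,\gamma}=\sqrt{2\gamma\tilde V_{\lambda,n}\ln n}+\frac{\gamma\ln n}{3n}\|\varphi_\lambda\|_\infty.$$ Let $j_0$ be the integer with $2^{j_0}\le n<2^{j_0+1}$ and $\Gamma_n=\{(j,k)\in\Lambda: j\le j_0\}$. The estimator is $\tilde f^H_{n,\gamma}=\sum_{\lambda\in\Gamma_n}\hat\beta_\lambda 1_{\{|\hat\beta_\lambda|\ge\eta_{\lambda,\gamma}\}}\varphi_\lambda$. *)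

(* Defs.v *)
From HB Require Import structures.
From mathcomp Require Import all_boot all_order all_algebra.
From mathcomp Require Import all_classical all_reals all_analysis.
Set Implicit Arguments. Unset Strict Implicit. Unset Printing Implicit Defensive.
Import Order.TTheory GRing.Theory Num.Theory.
Import numFieldNormedType.Exports.
Local Open Scope classical_set_scope.
Local Open Scope ring_scope.

Section Haar.
Variable R : realType.

Definition leb := (@lebesgue_measure R).

Definition haar_phi (x : R) : R := if (0 <= x <= 1) then 1 else 0.
Definition haar_psi (x : R) : R :=
  if (0 <= x <= 2^-1) then 1 else if (2^-1 < x <= 1) then -1 else 0.

(* varphi_lambda for lambda = (j,k), j >= -1 (j : int); j = -1 gives phi_k,
   j >= 0 gives psi_{j,k}(x) = 2^{j/2} psi(2^j x - k). *)
Definition varphi (j k : int) (x : R) : R :=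
  if (j < 0)%R then haar_phi (x - k%:~R)
  else Num.sqrt (2 ^+ `|j|%N) * haar_psi (2 ^+ `|j|%N * x - k%:~R).

Definition varphi_sup (j k : int) : R :=
  sup [set `|varphi j k x| | x in [set: R]].

(* Sum over k in Z of a (finitely supported) family: limit of the
   symmetric partial sums over -M <= k <= M. *)
Definition sumZ (u : int -> R) : R :=
  limn (fun M : nat => \sum_(i < M.*2.+1) u (i%:Z - M%:Z)).

Definition j0 (n : nat) : nat := trunc_log 2 n.

Definition sum_Gamma (n : nat) (F : int -> int -> R) : R :=
  \sum_(i < (j0 n).+2) sumZ (F (i%:Z - 1)).
Definition esum_Gamma (n : nat) (F : int -> int -> \bar R) : \bar R :=
  (\sum_(i < (j0 n).+2) \esum_(k in [set: int]) F (i%:Z - 1)%R k)%E.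

(* Estimator, from the points N = s (a finite list of points) *)
Definition beta_hat (n : nat) (s : seq R) j k : R :=
  n%:R^-1 * \sum_(T <- s) varphi j k T.
Definition V_hat (n : nat) (s : seq R) j k : R :=
  (n%:R ^+ 2)^-1 * \sum_(T <- s) varphi j k T ^+ 2.
Definition V_tilde (gamma : R) (n : nat) (s : seq R) j k : R :=
  V_hat n s j k
  + Num.sqrt (2 * gamma * ln n%:R * V_hat n s j k * (varphi_sup j k ^+ 2 / n%:R ^+ 2))
  + 3 * gamma * ln n%:R * (varphi_sup j k ^+ 2 / n%:R ^+ 2).
Definition eta (gamma : R) (n : nat) (s : seq R) j k : R :=
  Num.sqrt (2 * gamma * V_tilde gamma n s j k * ln n%:R)
  + gamma * ln n%:R / (3 * n%:R) * varphi_sup j k.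

Definition f_tilde (gamma : R) (n : nat) (s : seq R) (x : R) : R :=
  sum_Gamma n (fun j k =>
    beta_hat n s j k
    * (if `|beta_hat n s j k| >= eta gamma n s j k then 1 else 0)
    * varphi j k x).

Definition loss (gamma : R) (n : nat) (f : R -> R) (s : seq R) : \bar R :=
  (\int[leb]_x (((f_tilde gamma n s x - f x) ^+ 2)%:E))%E.

Fixpoint iter_int (nu : R -> R) (k : nat) (G : seq R -> \bar R) : \bar R :=
  match k with
  | 0 => G [::]
  | k'.+1 => (\int[leb]_t ((nu t)%:E * iter_int nu k' (fun s => G (t :: s))))%E
  end.

(* Expectation of a nonnegative functional G of a Poisson process on R with
   (finite) intensity measure nu(t) dt: with m = \int nu, the number of points
   is Poisson(m) and, given k points, they are i.i.d. with density nu/m. *)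
Definition poisson_exp (nu : R -> R) (G : seq R -> \bar R) : \bar R :=
  let m := fine (\int[leb]_t (nu t)%:E)%E in
  (\sum_(0 <= k <oo) ((expR (- m) / (k`!)%:R)%:E * iter_int nu k G))%E.

Definition beta (f : R -> R) j k : R := fine (\int[leb]_x ((varphi j k x * f x)%:E))%E.
Definition Fmass (f : R -> R) j k : \bar R :=
  (\int[leb]_(x in [set x | varphi j k x != 0%R]) (f x)%:E)%E.
Definition Vn (n : nat) (f : R -> R) j k : R :=
  n%:R^-1 * fine (\int[leb]_x ((varphi j k x ^+ 2 * f x)%:E))%E.

Definition Fclass (n : nat) (R0 : R) : set (R -> R) :=
  [set f : R -> R | measurable_fun [set: R] f
     /\ (forall x, 0 <= f x)
     /\ (Lnorm leb 1%:E (fun x => (f x)%:E) <= R0%:E)%E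
     /\ (Lnorm leb 2%:E (fun x => (f x)%:E) <= R0%:E)%E
     /\ (Lnorm leb +oo (fun x => (f x)%:E) <= R0%:E)%E
     /\ (forall j k : int, (-1 <= j)%R ->
           ((ln n%:R * ln (ln n%:R) / n%:R * (beta f j k != 0)%:R)%:E
              <= Fmass f j k)%E)].

Definition risk_ratio (gamma : R) (n : nat) (f : R -> R) : \bar R :=
  (poisson_exp (fun t => (n%:R * f t)%R) (loss gamma n f)
   * (esum_Gamma n (fun j k => (Num.min (beta f j k ^+ 2) (Vn n f j k))%:E)
      + ((n%:R)^-1)%R%:E)^-1)%E.

End Haar.

(* Main.v *)
(** The test intensity is [f = 1_[0,1) + a * sum_(k < 2^J) psi_(J,k)] with
    [a = (sqrt gamma - sqrt gamma_min) * sqrt (2 ln n / n)] and [2^J] of order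
    [sqrt n].  Only [phi_0] and the [2^J] wavelets of level [J] have a nonzero
    coefficient and their variance is [1 / n], so the oracle term is at most
    [(2^J + 2) / n].  The threshold at level [J] is close to
    [sqrt (2 gamma ln n / n)], and the fluctuation of an empirical coefficient
    around [a] would have to exceed a multiple of [sqrt (ln n / n)] for it to be
    kept: Chebyshev's inequality bounds the probability of this by
    [O(1 / ln n + 2^J / n)].  Each coefficient which is killed costs [a ^ 2], hence
    the risk is at least [2^J a^2 (1 - o(1))].

    No measurability of the loss is needed: the iterated integrals defining the
    Poisson expectation are lower integrals, and the loss is minorised by a
    quadratic polynomial in sums over the points of the process, whose expectation
    is given by Campbell's formula. *)

Require Import Defs.
From HB Require Import structures.
From mathcomp Require Import all_boot all_order all_algebra.
From mathcomp Require Import all_classical all_reals all_analysis.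
From mathcomp Require Import measurable_realfun ess_sup_inf ring lra zify.
Import Order.TTheory GRing.Theory Num.Theory.
Import numFieldNormedType.Exports.
Local Open Scope classical_set_scope.
Local Open Scope ring_scope.
Set Implicit Arguments. Unset Strict Implicit. Unset Printing Implicit Defensive.

(** * Integrals of signed real functions, as a linear relation *)

Section HasInt.
Variable R : realType.
Implicit Types (f g h : R -> R) (u v c : R).

(** Integrability and value travel together, so that linear combinations need no separate finiteness
    argument. *)
Definition has_int f v :=
  (@leb R).-integrable setT (EFin \o f) /\ (\int[@leb R]_x (f x)%:E)%E = v%:E.

Lemma has_int_eq f g u v : f =1 g -> u = v -> has_int f u -> has_int g v.
Proof. by move=> /funext -> ->. Qed.

Lemma has_int_ext f g v : has_int f v -> f =1 g -> has_int g v.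
Proof. by move=> /[swap] /funext ->. Qed.

Lemma has_intZ c f v : has_int f v -> has_int (fun x => c * f x) (c * v).
Proof.
move=> [intf fv]; split.
  rewrite (_ : _ \o _ = fun x => c%:E * (EFin \o f) x)%E; first exact: integrableZl.
  by apply/funext => x /=; rewrite EFinM.
under eq_integral do rewrite EFinM.
by rewrite integralZl// fv.
Qed.

Lemma has_intD f g u v : has_int f u -> has_int g v ->
  has_int (fun x => f x + g x) (u + v).
Proof.
move=> [intf fu] [intg gv]; split.
  rewrite (_ : _ \o _ = (EFin \o f) \+ (EFin \o g))%E; first exact: integrableD.
  by apply/funext => x /=; rewrite EFinD.
under eq_integral do rewrite EFinD.
by rewrite (integralD_EFin _ intf intg)//= fu gv.
Qed.

Lemma has_intB f g u v : has_int f u -> has_int g v ->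
  has_int (fun x => f x - g x) (u - v).
Proof.
move=> hf /(has_intZ (-1)) /(has_intD hf); apply: has_int_eq => [x|]; by rewrite mulN1r.
Qed.

Lemma has_int0 : has_int (fun=> 0) 0.
Proof. by split; [exact: integrable0|rewrite integral0]. Qed.

Lemma has_int_sum (I : Type) (s : seq I) (P : pred I) (F : I -> R -> R) (V : I -> R) :
  (forall i, P i -> has_int (F i) (V i)) ->
  has_int (fun x => \sum_(i <- s | P i) F i x) (\sum_(i <- s | P i) V i).
Proof.
move=> FV; elim: s => [|i s IH].
  by apply: has_int_eq has_int0 => [x|]; rewrite big_nil.
case: (boolP (P i)) => Pi.
  by apply: has_int_eq (has_intD (FV i Pi) IH) => [x|]; rewrite big_cons Pi.
by apply: has_int_eq IH => [x|]; rewrite big_cons (negbTE Pi).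
Qed.

Lemma has_int_indic (a b : R) : a <= b -> has_int \1_(`[a, b[) (b - a).
Proof.
move=> ab; have eqi : (\int[@leb R]_x (\1_(`[a, b[) x : R)%:E = (b - a)%:E)%E.
  rewrite integral_indic// setIT /leb; have /= -> := lebesgue_measure_itv `[a, b[.
  rewrite lte_fin.
  by move: ab; rewrite le_eqVlt => /orP[/eqP ->|->]; rewrite ?ltxx ?subrr// EFinB.
split=> //; apply/integrableP; split.
  by apply/measurable_EFinP; exact: measurable_indic.
rewrite (_ : (fun x => _) = fun x => (\1_(`[a, b[) x : R)%:E); first by rewrite eqi ltry.
by apply/funext => x /=; rewrite ger0_norm// indicE.
Qed.

Lemma has_int_measurable f v : has_int f v -> measurable_fun setT f.
Proof. by move=> [/integrableP[/measurable_EFinP]]. Qed.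

(** Countable sets are Lebesgue-null. This carries integrals from half-open Haar functions over to
    the closed-interval ones of the statement. *)
Lemma has_int_countable (D : set R) f g v : countable D ->
  measurable_fun setT g -> (forall x, ~ D x -> f x = g x) ->
  has_int f v -> has_int g v.
Proof.
move=> cD mg fg [intf fv].
have ae : ae_eq (@leb R) setT (EFin \o f) (EFin \o g).
  exists D; split.
  - exact: countable_measurable.
  - exact: countable_lebesgue_measure0.
  - by move=> x /=; apply: contra_notP => nDx _; rewrite fg.
have mf : measurable_fun setT (EFin \o f) by case/integrableP : intf.
have mg' : measurable_fun setT (EFin \o g) by apply/measurable_EFinP.
split.
  apply/integrableP; split=> //; case/integrableP : intf => _; congr (_ < _)%E.
  by apply: ae_eq_integral; [| | |exact: ae_eq_abse]; [|exact: measurableT_comp..].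
by rewrite -fv; apply: ae_eq_integral; [| | |exact: ae_eq_sym].
Qed.

(* [ge0_le_integral] asks both sides to be measurable; here the larger one is
   arbitrary, its integral being the lower integral. *)
Lemma nonneg_le_integral (F G : R -> \bar R) :
  (forall x, 0 <= F x)%E -> (forall x, F x <= G x)%E ->
  (\int[@leb R]_x F x <= \int[@leb R]_x G x)%E.
Proof.
move=> F0 FG.
rewrite !ge0_integralTE//; last by move=> x; exact: le_trans (F0 x) (FG x).
apply: le_ereal_sup => _ [h hF <-]; exists h => // x.
exact: le_trans (hF x) (FG x).
Qed.

(** [F] may be non-measurable. Dropping the negative part of [r], whose integral is finite, only
    raises the integral, and the positive part lies below [F]. *)
Lemma has_int_le_integral (r : R -> R) v (F : R -> \bar R) : has_int r v ->
  (forall x, 0 <= F x)%E -> (forall x, (r x)%:E <= F x)%E ->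
  (v%:E <= \int[@leb R]_x F x)%E.
Proof.
move=> [intr rv] F0 rF; rewrite -rv.
apply: (@le_trans _ _ (\int[@leb R]_x (maxe (r x)%:E 0)))%E.
  rewrite integralE; apply: (@le_trans _ _ (\int[@leb R]_x ((EFin \o r)^\+ x)))%E.
    by rewrite leeBlDr ?leeDl ?integral_ge0//; have := integrable_neg_fin_num _ intr; apply.
  by apply: nonneg_le_integral => x; rewrite ?funepos_ge0// funeposE.
by apply: nonneg_le_integral => x; rewrite ?le_max ?lexx ?orbT// ge_max rF F0.
Qed.

End HasInt.

(** * Dyadic indicators and half-open Haar functions *)

Section Dyadic.
Variable R : realType.
Implicit Types (x : R) (j k : int) (p q : nat).

(** The indicator of a dyadic interval, written with [floor] so that nesting of intervals becomes
    integer division. *)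
Definition chi p k x : R := (Num.floor (2 ^+ p * x) == k)%:R.

Lemma chiE p k : chi p k = \1_(`[k%:~R / 2 ^+ p, (k + 1)%:~R / 2 ^+ p[).
Proof.
apply/funext => x; rewrite /chi indicE floor_eq; congr (nat_of_bool _)%:R.
apply/idP/idP; rewrite ?inE/= in_itv/= ler_pdivrMr ?ltr_pdivlMr ?exprn_gt0//;
  by rewrite mulrC.
Qed.

Lemma has_int_chi p k : has_int (chi p k) (2 ^- p).
Proof.
rewrite chiE; have := @has_int_indic R (k%:~R / 2 ^+ p) ((k + 1)%:~R / 2 ^+ p).
rewrite ler_pM2r ?invr_gt0 ?exprn_gt0// ler_int lerDl => /(_ isT).
apply: has_int_eq => //.
by rewrite intrD -mulrBl addrAC subrr add0r mul1r.
Qed.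

Lemma floor_div_expn (y : R) q :
  Num.floor y = (Num.floor (2 ^+ q * y) %/ 2 ^+ q)%Z.
Proof.
set m := Num.floor (2 ^+ q * y); have q0 : 0 < 2 ^+ q :> R by rewrite exprn_gt0.
have /andP[lm um] := floor_itv (2 ^+ q * y); rewrite -/m in lm um.
have z0 : 0 < 2 ^+ q :> int by rewrite exprn_gt0.
apply: floor_def; apply/andP; split.
  rewrite -(ler_pM2l q0); apply: le_trans lm.
  rewrite -[2 ^+ q]/(2%:~R ^+ q) -rmorphXn -rmorphM ler_int mulrC.
  by rewrite lez_floor// gt_eqF.
rewrite -(ltr_pM2l q0); apply: (lt_le_trans um).
rewrite -[2 ^+ q]/(2%:~R ^+ q) -rmorphXn -rmorphM ler_int mulrC.
by rewrite lezD1; exact: ltz_ceil.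
Qed.

(** Dyadic intervals are nested or disjoint: the finer interval [k'] has exactly one ancestor at
    level [p], of index [k' %/ 2 ^ q]. *)
Lemma chi_mul p k q k' x :
  chi p k x * chi (p + q) k' x = (k == (k' %/ 2 ^+ q)%Z)%:R * chi (p + q) k' x.
Proof.
rewrite /chi (floor_div_expn (2 ^+ p * x) q) mulrA -exprD addnC.
have [->|_] := eqVneq (Num.floor _) k'; last by rewrite !mulr0.
by rewrite !mulr1 eq_sym.
Qed.

(** Half-open variant of $\psi_{p,k}$: a rescaled difference of the indicators of the two halves of
    its support. *)
Definition hpsi p k x : R :=
  Num.sqrt (2 ^+ p) * (chi p.+1 (2 * k) x - chi p.+1 (2 * k + 1) x).

Lemma divz_exp2_succ k q : ((2 * k) %/ 2 ^+ q.+1 = (2 * k + 1) %/ 2 ^+ q.+1)%Z.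
Proof.
rewrite exprS !divzMA_ge0//; congr (_ %/ _)%Z.
by rewrite mulrC mulzK// divzMDl// divz_small ?addr0.
Qed.

(** The two halves of the wavelet have equal lengths and the same ancestor at level [p], so their
    contributions cancel. *)
Lemma chi_hpsi p k q k' : has_int (fun x => chi p k x * hpsi (p + q) k' x) 0.
Proof.
have h i : has_int (fun x => chi p k x * chi (p + q.+1) i x)
                   ((k == (i %/ 2 ^+ q.+1)%Z)%:R * 2 ^- (p + q.+1)).
  by apply: has_int_eq (has_intZ (k == (i %/ 2 ^+ q.+1)%Z)%:R (has_int_chi (p + q.+1) i)) => // x;
     rewrite chi_mul.
have := has_intZ (Num.sqrt (2 ^+ (p + q))) (has_intB (h (2 * k')) (h (2 * k' + 1))).
apply: has_int_eq => [x|]; last by rewrite divz_exp2_succ subrr mulr0.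
by rewrite /hpsi addnS; ring.
Qed.

(** Supports at one level are disjoint, and both signs square to one; only the squared norming
    factor [2 ^+ p] remains. *)
Lemma hpsi_mul p k k' x :
  hpsi p k x * hpsi p k' x = (k == k')%:R * (2 ^+ p * chi p k x).
Proof.
have chi_split : chi p k x = chi p.+1 (2 * k) x + chi p.+1 (2 * k + 1) x.
  rewrite /chi (floor_div_expn (2 ^+ p * x) 1) mulrA -exprD add1n expr1.
  set m := Num.floor _; have := divz_eq m 2.
  have := modz_ge0 m (isT : (2 : int) != 0); have := ltz_pmod m (isT : 0 < (2 : int)).
  set d := (m %/ 2)%Z; set r := (m %% 2)%Z => r2 r0 em.
  have [er | er] : r = 0 \/ r = 1 by lia.
    have -> : (m == 2 * k) = (d == k) by apply/eqP/eqP; lia.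
    by rewrite (_ : m == 2 * k + 1 = false) ?addr0//; apply/negP => /eqP; lia.
  have -> : (m == 2 * k + 1) = (d == k) by apply/eqP/eqP; lia.
  by rewrite (_ : m == 2 * k = false) ?add0r//; apply/negP => /eqP; lia.
have -> : hpsi p k x * hpsi p k' x = 2 ^+ p *
    ((chi p.+1 (2 * k) x - chi p.+1 (2 * k + 1) x) *
     (chi p.+1 (2 * k') x - chi p.+1 (2 * k' + 1) x)).
  by rewrite /hpsi mulrACA -expr2 sqr_sqrtr ?exprn_ge0.
rewrite chi_split [RHS]mulrCA; congr (_ * _); rewrite /chi.
set m := Num.floor _.
have [<-|/eqP kk'] := eqVneq k k'.
  have [->|_] := eqVneq m (2 * k); last by case: (m == _) => /=; ring.
  by rewrite (_ : 2 * k == 2 * k + 1 = false) /=; [ring|apply/negP => /eqP; lia].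
have ne (b : int) : b = 0 \/ b = 1 -> m = 2 * k + b ->
    (m == 2 * k') = false /\ (m == 2 * k' + 1) = false.
  by move=> b01 ->; split; apply/negP => /eqP; lia.
have [e1|_] := eqVneq m (2 * k).
  by have [-> ->] := ne 0 (or_introl erefl) (etrans e1 (esym (addr0 _))); rewrite subrr mulr0 mul0r.
have [e1|_] := eqVneq m (2 * k + 1); last by rewrite /= addr0 !subr0 !mul0r.
by have [-> ->] := ne 1 (or_intror erefl) e1; rewrite subrr mulr0 mul0r.
Qed.

Lemma hpsi_hpsi p k q k' :
  has_int (fun x => hpsi p k x * hpsi q k' x) ((p == q) && (k == k'))%:R.
Proof.
wlog le_pq : p q k k' / (p <= q)%N => [H|].
  have [le_pq|/ltnW le_qp] := leqP p q; first exact: H.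
  have := H q p k' k le_qp; rewrite (eq_sym q) (eq_sym k').
  by apply: has_int_eq => // x; exact: mulrC.
move: le_pq; rewrite leq_eqVlt => /orP[/eqP <-|lt_pq].
  apply: has_int_eq (has_intZ (k == k')%:R (has_intZ (2 ^+ p) (has_int_chi p k))) => [x|].
    by rewrite hpsi_mul.
  by rewrite mulfV ?mulr1 ?eqxx// gt_eqF// exprn_gt0.
(* The coarser wavelet is a combination of indicators of level [p.+1 <= q], each orthogonal to the
   finer wavelet. *)
have := has_intB (chi_hpsi p.+1 (2 * k) (q - p.+1) k') (chi_hpsi p.+1 (2 * k + 1) (q - p.+1) k').
move/(has_intZ (Num.sqrt (2 ^+ p))); rewrite subnKC//; apply: has_int_eq => [x|].
  by rewrite /hpsi; ring.
by rewrite subrr mulr0 ltn_eqF.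
Qed.

Definition hvar j k x : R := if j < 0 then chi 0 k x else hpsi `|j|%N k x.

Lemma hvar_hvar j k j' k' : -1 <= j -> -1 <= j' ->
  has_int (fun x => hvar j k x * hvar j' k' x) ((j == j') && (k == k'))%:R.
Proof.
move=> j1 j1'; rewrite /hvar; case: ltP => hj; case: ltP => hj'.
- have [-> ->] : j = -1 /\ j' = -1 by lia.
  have := has_intZ (k == k')%:R (has_int_chi 0 k'); apply: has_int_eq => [x|].
    by rewrite (chi_mul 0 k 0 k') expr0 divz1.
  by rewrite eqxx /= expr0 invr1 mulr1.
- have := chi_hpsi 0 k `|j'| k'; apply: has_int_eq => //.
  by rewrite (_ : j == j' = false)//; apply/negP => /eqP; lia.
- have := chi_hpsi 0 k' `|j| k; apply: has_int_eq => [x|]; first by rewrite mulrC.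
  by rewrite (_ : j == j' = false)//; apply/negP => /eqP; lia.
- have := hpsi_hpsi `|j| k `|j'| k'; apply: has_int_eq => //.
  by congr ((_ && _)%:R); apply/eqP/eqP; lia.
Qed.

Definition dyadics : set R := range (fun pk : nat * int => pk.2%:~R / 2 ^+ pk.1).

Lemma countable_dyadics : countable dyadics.
Proof. by apply: sub_countable (countableP _); exact: card_image_le. Qed.

(** The closed and half-open conventions disagree only at ends and midpoints of supports, all of
    them dyadic. *)
Lemma varphi_hvar j k x : ~ dyadics x -> varphi j k x = hvar j k x.
Proof.
move=> Dx.
have nd p i : 2 ^+ p * x <> i%:~R.
  move=> e; apply: Dx; exists (p, i) => //=; rewrite -e mulrAC mulfV ?mul1r//.
rewrite /varphi /hvar; case: ltP => hj.
  have /eqP := nd 0 (k + 1); rewrite expr0 mul1r intrD neq_lt => ne.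
  rewrite /haar_phi /chi floor_eq expr0 mul1r intrD.
  have -> : (0 <= x - k%:~R <= 1) = (k%:~R <= x < k%:~R + 1).
    by case/orP : ne => ne; apply/idP/idP; lra.
  by case: ifP.
rewrite /hpsi; congr (_ * _); set p := `|j|%N.
(* [n0], [n1] and [n2] keep [x] off the left end, the right end and the midpoint of the support,
   which makes strict and weak inequalities interchangeable there. *)
have n0 : (2 ^+ p * x < k%:~R) || (k%:~R < 2 ^+ p * x) by rewrite -neq_lt; apply/eqP/nd.
have n1 : (2 ^+ p * x < k%:~R + 1) || (k%:~R + 1 < 2 ^+ p * x).
  by rewrite -neq_lt; apply/eqP; have := nd p (k + 1); rewrite intrD.
have n2 : (2 * (2 ^+ p * x) < 2 * k%:~R + 1) || (2 * k%:~R + 1 < 2 * (2 ^+ p * x)).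
  by rewrite -neq_lt; apply/eqP; have := nd p.+1 (2 * k + 1); rewrite intrD intrM exprS -mulrA.
rewrite /chi !floor_eq /haar_psi exprS -mulrA !intrD !intrM -[2%:~R]/(2 : R).
move: (2 ^+ p * x) (k%:~R) n0 n1 n2 => y K n0 n1 n2.
have -> : (0 <= y - K <= 2^-1) = (2 * K <= 2 * y < 2 * K + 1).
  by case/orP : n2 => n2; apply/idP/idP; lra.
have -> : (2^-1 < y - K <= 1) = (2 * K + 1 <= 2 * y < 2 * K + 1 + 1).
  by case/orP : n2 => n2; case/orP : n1 => n1; apply/idP/idP; lra.
case: ifP => h; last by case: ifP => _; rewrite sub0r ?oppr0.
by rewrite (_ : (_ <= _ < _) = false) ?subr0//; apply/negP; lra.
Qed.

End Dyadic.

(** * Moments of Poisson sums *)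

Section PoissonMoments.
Variable R : realType.
Implicit Types (nu h : R -> R) (P Q : seq R -> R) (G : seq R -> \bar R) (c d u v w m : R).

(* Relational form of [iter_int] for signed functionals: integrability is
   required at every stage, which makes it linear in [P]. *)
Fixpoint iter_val nu (k : nat) P v : Prop :=
  match k with
  | 0 => P [::] = v
  | k'.+1 => exists2 r, (forall t, iter_val nu k' (fun s => P (t :: s)) (r t)) &
               has_int (fun t => nu t * r t) v
  end.

Lemma iter_int_ge0 nu k G : (forall t, 0 <= nu t) -> (forall s, 0 <= G s)%E ->
  (0 <= iter_int nu k G)%E.
Proof.
move=> nu0; elim: k G => [|k IH] G G0 /=; first exact: G0.
by apply: integral_ge0 => t _; rewrite mule_ge0 ?lee_fin// IH.
Qed.

Lemma iter_val_le nu k G P v : (forall t, 0 <= nu t) -> (forall s, 0 <= G s)%E ->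
  (forall s, (P s)%:E <= G s)%E -> iter_val nu k P v -> (v%:E <= iter_int nu k G)%E.
Proof.
move=> nu0; elim: k G P v => [|k IH] G P v G0 PG /=; first by move=> <-.
move=> [r Pr rv]; apply: (has_int_le_integral rv) => t.
  by rewrite mule_ge0 ?lee_fin// iter_int_ge0.
by rewrite EFinM lee_wpmul2l ?lee_fin//; apply: IH (Pr t).
Qed.

Lemma iter_val_ext nu k P Q v : P =1 Q -> iter_val nu k P v -> iter_val nu k Q v.
Proof. by move=> /funext ->. Qed.

Lemma iter_valZ nu k c P v : iter_val nu k P v -> iter_val nu k (fun s => c * P s) (c * v).
Proof.
elim: k P v => [|k IH] P v /=; first by move=> ->.
move=> [r Pr rv]; exists (fun t => c * r t) => [t|]; first exact: IH.
by apply: has_int_ext (has_intZ c rv) _ => t; rewrite mulrCA.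
Qed.

Lemma iter_valD nu k P Q u v : iter_val nu k P u -> iter_val nu k Q v ->
  iter_val nu k (fun s => P s + Q s) (u + v).
Proof.
elim: k P Q u v => [|k IH] P Q u v /=; first by move=> -> ->.
move=> [r Pr ru] [q Qq qv]; exists (fun t => r t + q t) => [t|]; first exact: IH.
by apply: has_int_ext (has_intD ru qv) _ => t; rewrite mulrDr.
Qed.

Lemma iter_val_cst nu k m c : has_int nu m -> iter_val nu k (fun=> c) (c * m ^+ k).
Proof.
move=> num; elim: k => [|k IH] /=; first by rewrite expr0 mulr1.
exists (fun=> c * m ^+ k) => //.
apply: has_int_eq (has_intZ (c * m ^+ k) num) => [t|]; first exact: mulrC.
by rewrite -mulrA exprSr.
Qed.

(** Expanding the square leaves [d ^+ 2], one term per point and one per ordered pair of distinct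
    points; every other point contributes a factor [m]. Where [k.-1] or [k.-2] truncates, its
    coefficient vanishes. *)
Lemma iter_val_sq nu h m u w k d : has_int nu m ->
  has_int (fun t => nu t * h t) u -> has_int (fun t => nu t * h t ^+ 2) w ->
  iter_val nu k (fun s => (\sum_(T <- s) h T - d) ^+ 2)
    (d ^+ 2 * m ^+ k + (w - 2 * d * u) * (k%:R * m ^+ k.-1)
     + u ^+ 2 * (k%:R * k.-1%:R * m ^+ k.-2)).
Proof.
move=> num nuu nuw; elim: k d => [|k IH] d /=.
  by rewrite big_nil sub0r sqrrN expr0 mulr1 !mul0r !mulr0 !addr0.
pose M1 := k%:R * m ^+ k.-1; pose M2 := k%:R * k.-1%:R * m ^+ k.-2.
(* Fixing the first point [t] leaves the same functional of the other [k] points, centred at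
   [d - h t]; hence the induction with [d] general. *)
exists (fun t => (d - h t) ^+ 2 * m ^+ k + (w - 2 * (d - h t) * u) * M1 + u ^+ 2 * M2).
  move=> t; apply: iter_val_ext (IH (d - h t)) => s.
  by rewrite big_cons; congr (_ ^+ 2); ring.
have := has_intD (has_intD
  (has_intZ (d ^+ 2 * m ^+ k + (w - 2 * d * u) * M1 + u ^+ 2 * M2) num)
  (has_intZ (2 * u * M1 - 2 * d * m ^+ k) nuu))
  (has_intZ (m ^+ k) nuw).
apply: has_int_eq => [t|]; first by ring.
have e1 : m * M1 = k%:R * m ^+ k.
  by rewrite /M1; case: k {IH M1 M2} => [|k]; rewrite ?mul0r ?mulr0// exprS /=; ring.
have e2 : m * M2 = k%:R * k.-1%:R * m ^+ k.-1.
  rewrite /M2; case: k {IH M1 M2 e1} => [|[|k]]; rewrite ?mul0r ?mulr0 ?mul0r ?mulr0//.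
  by rewrite exprS /=; ring.
have e3 : u ^+ 2 * (k.+1%:R * k%:R * m ^+ k.-1) = u ^+ 2 * (2 * M1 + m * M2).
  rewrite e2 /M1; case: k {IH M1 M2 e1 e2} => [|k]; first by rewrite /=; ring.
  by rewrite -!natr1 /=; ring.
rewrite e3 -[k.+1%:R]natr1 [m ^+ k.+1]exprS.
transitivity (d ^+ 2 * (m * m ^+ k) + (w - 2 * d * u) * (m * M1 + m ^+ k)
    + u ^+ 2 * (2 * M1 + m * M2)).
  by ring.
by rewrite e1 /=; clearbody M1 M2; ring.
Qed.

Definition poisson_val nu P v := exists2 V : nat -> R,
  (forall k, iter_val nu k P (V k)) &
  (fun K => \sum_(0 <= k < K)
     expR (- fine (\int[@leb R]_t (nu t)%:E)%E) / k`!%:R * V k) @ \oo --> v.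

(** Turns expectations of explicit polynomials into lower bounds for the risk: partial sums for [P]
    are dominated termwise by those for [G], which lie below the full series of nonnegative
    terms. *)
Lemma poisson_val_le nu G P v : (forall t, 0 <= nu t) -> (forall s, 0 <= G s)%E ->
  (forall s, (P s)%:E <= G s)%E -> poisson_val nu P v -> (v%:E <= poisson_exp nu G)%E.
Proof.
move=> nu0 G0 PG [V PV Vv]; rewrite /poisson_exp /=.
set e := expR _ in Vv *.
have e0 k : 0 <= e / k`!%:R by rewrite divr_ge0// expR_ge0.
have cv : (EFin \o fun K => \sum_(0 <= k < K) e / k`!%:R * V k) @ \oo --> v%:E.
  by apply: cvg_EFin => //; exact: nearW.
rewrite -(cvg_lim _ cv)//; apply: lime_le; first by apply/cvg_ex; exists v%:E.
near=> K => /=; rewrite -sumEFin; apply: le_trans (nneseries_lim_ge K _) => /=.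
  apply: lee_sum => k _; rewrite EFinM lee_wpmul2l ?lee_fin//.
  exact: (iter_val_le (P := P)).
by move=> k _ _; rewrite mule_ge0 ?lee_fin// iter_int_ge0.
Unshelve. all: by end_near. Qed.

Lemma poisson_val_ext nu P Q v : P =1 Q -> poisson_val nu P v -> poisson_val nu Q v.
Proof. by move=> /funext ->. Qed.

Lemma poisson_valZ nu c P v : poisson_val nu P v ->
  poisson_val nu (fun s => c * P s) (c * v).
Proof.
move=> [V PV Vv]; exists (fun k => c * V k) => [k|]; first exact: iter_valZ.
rewrite (_ : (fun K => _) = fun K => c * \sum_(0 <= k < K)
     expR (- fine (\int[@leb R]_t (nu t)%:E)%E) / k`!%:R * V k).
  by apply: cvgM => //; exact: cvg_cst.
by apply/funext => K; rewrite big_distrr; apply: eq_bigr => k _; rewrite /= mulrCA.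
Qed.

Lemma poisson_valD nu P Q u v : poisson_val nu P u -> poisson_val nu Q v ->
  poisson_val nu (fun s => P s + Q s) (u + v).
Proof.
move=> [V PV Vv] [W QW Wv]; exists (fun k => V k + W k) => [k|]; first exact: iter_valD.
rewrite (_ : (fun K => _) = fun K => \sum_(0 <= k < K)
     expR (- fine (\int[@leb R]_t (nu t)%:E)%E) / k`!%:R * V k + \sum_(0 <= k < K)
     expR (- fine (\int[@leb R]_t (nu t)%:E)%E) / k`!%:R * W k).
  exact: cvgD.
by apply/funext => K; rewrite -big_split; apply: eq_bigr => k _; rewrite /= mulrDr.
Qed.

Lemma eq_cvgn (f g : nat -> R) v : f =1 g -> f @ \oo --> v -> g @ \oo --> v.
Proof. by move=> /funext ->. Qed.

Definition poisson_wgt m k := expR (- m) / k`!%:R : R.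

Lemma poisson_moment0 m :
  (fun K => \sum_(0 <= k < K) poisson_wgt m k * m ^+ k) @ \oo --> (1 : R).
Proof.
rewrite -[X in _ --> X](mulVf (lt0r_neq0 (expR_gt0 m))) -expRN.
rewrite (_ : (fun K => _) = fun K => expR (- m) * series (exp_coeff m) K).
  by apply: cvgM; [exact: cvg_cst|exact: is_cvg_series_exp_coeff].
apply/funext => K; rewrite /series /= big_distrr; apply: eq_bigr => k _ /=.
by rewrite /poisson_wgt /exp_coeff /=; ring.
Qed.

(** First factorial moment with its power of [m] removed: as [k / k! = 1 / (k - 1)!], shifting the
    index gives the total mass. *)
Lemma poisson_moment1 m :
  (fun K => \sum_(0 <= k < K) poisson_wgt m k * (k%:R * m ^+ k.-1)) @ \oo --> (1 : R).
Proof.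
rewrite -(cvg_shiftS _ _); apply: eq_cvgn (@poisson_moment0 m) => K.
rewrite [RHS]big_nat_recl//= mul0r mulr0 add0r.
apply: eq_bigr => k _; rewrite /poisson_wgt factS natrM; field.
by rewrite nat1r !pnatr_eq0 -!lt0n fact_gt0.
Qed.

Lemma poisson_moment2 m :
  (fun K => \sum_(0 <= k < K) poisson_wgt m k * (k%:R * k.-1%:R * m ^+ k.-2)) @ \oo --> (1 : R).
Proof.
rewrite -(cvg_shiftS _ _); apply: eq_cvgn (@poisson_moment1 m) => K.
rewrite [RHS]big_nat_recl//= !mul0r mulr0 add0r.
apply: eq_bigr => k _; rewrite /poisson_wgt factS natrM /=; field.
by rewrite nat1r !pnatr_eq0 -!lt0n fact_gt0.
Qed.

Lemma poisson_val_cst nu m c : has_int nu m -> poisson_val nu (fun=> c) c.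
Proof.
move=> num; exists (fun k => c * m ^+ k) => [k|]; first exact: iter_val_cst.
rewrite num.2 /= -[X in _ --> X]mulr1.
rewrite (_ : (fun K => _) = fun K => c * \sum_(0 <= k < K) poisson_wgt m k * m ^+ k).
  by apply: cvgM; [exact: cvg_cst|exact: poisson_moment0].
by apply/funext => K; rewrite big_distrr; apply: eq_bigr => k _; rewrite /= mulrCA.
Qed.

Lemma poisson_val_sum nu m (I : Type) (r : seq I) (P : I -> seq R -> R) (v : I -> R) :
  has_int nu m -> (forall i, poisson_val nu (P i) (v i)) ->
  poisson_val nu (fun s => \sum_(i <- r) P i s) (\sum_(i <- r) v i).
Proof.
move=> num Pv; elim: r => [|i r IH].
  by rewrite big_nil; apply: poisson_val_ext (poisson_val_cst 0 num) => s; rewrite big_nil.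
by rewrite big_cons; apply: poisson_val_ext (poisson_valD (Pv i) IH) => s; rewrite big_cons.
Qed.

(* Campbell's formula: mean [u] and variance [w]. *)
Lemma poisson_val_sq nu h m u w d : has_int nu m ->
  has_int (fun t => nu t * h t) u -> has_int (fun t => nu t * h t ^+ 2) w ->
  poisson_val nu (fun s => (\sum_(T <- s) h T - d) ^+ 2) ((u - d) ^+ 2 + w).
Proof.
move=> num nuu nuw; eexists => [k|]; first exact: (iter_val_sq _ _ num nuu nuw).
have -> : (u - d) ^+ 2 + w = d ^+ 2 * 1 + (w - 2 * d * u) * 1 + u ^+ 2 * 1 by ring.
have cv : (fun K => d ^+ 2 * (\sum_(0 <= k < K) poisson_wgt m k * m ^+ k)
    + (w - 2 * d * u) * (\sum_(0 <= k < K) poisson_wgt m k * (k%:R * m ^+ k.-1))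
    + u ^+ 2 * (\sum_(0 <= k < K) poisson_wgt m k * (k%:R * k.-1%:R * m ^+ k.-2)))
    @ \oo --> d ^+ 2 * 1 + (w - 2 * d * u) * 1 + u ^+ 2 * 1.
  apply: cvgD; [apply: cvgD|]; apply: cvgM; try exact: cvg_cst.
  - exact: poisson_moment0.
  - exact: poisson_moment1.
  - exact: poisson_moment2.
apply: eq_cvgn cv => K /=; rewrite num.2 /=.
rewrite !big_distrr -!big_split /=; apply: eq_bigr => k _.
by rewrite /poisson_wgt; ring.
Qed.

End PoissonMoments.

(** * Haar coefficients of the test intensity *)

Section HaarIntegrals.
Variable R : realType.
Implicit Types (x a c : R) (j k : int) (J n : nat) (s : seq R).

Lemma measurable_haar_phi : measurable_fun setT (@haar_phi R).
Proof.
rewrite (_ : @haar_phi R = \1_(`[0, 1])); first exact: measurable_indic.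
by apply/funext => x; rewrite /haar_phi indicE mem_setE in_itv /=; case: ifP.
Qed.

Lemma measurable_haar_psi : measurable_fun setT (@haar_psi R).
Proof.
rewrite (_ : @haar_psi R = fun x => \1_(`[0, 2^-1]) x - \1_(`]2^-1, 1]) x).
  by apply: measurable_funB; exact: measurable_indic.
apply/funext => x; rewrite /haar_psi !indicE !mem_setE !in_itv /=.
case: ifP => h1; last by case: ifP => _; rewrite sub0r ?oppr0.
by rewrite (_ : (2^-1 < x <= 1) = false) ?subr0//; apply/negP; lra.
Qed.

Lemma measurable_varphi j k : measurable_fun setT (@varphi R j k).
Proof.
case hj : (j < 0).
  rewrite (_ : varphi j k = fun x => haar_phi (x - k%:~R)); last first.
    by apply/funext => x; rewrite /varphi hj.
  apply: (measurableT_comp measurable_haar_phi).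
  by apply: measurable_funB; [exact: measurable_id|exact: measurable_cst].
rewrite (_ : varphi j k =
    fun x => Num.sqrt (2 ^+ `|j|%N) * haar_psi (2 ^+ `|j|%N * x - k%:~R)); last first.
  by apply/funext => x; rewrite /varphi hj.
apply: measurable_funM; first exact: measurable_cst.
apply: (measurableT_comp measurable_haar_psi).
apply: measurable_funB; last exact: measurable_cst.
by apply: measurable_funM; [exact: measurable_cst|exact: measurable_id].
Qed.

Lemma measurable_chi J k : measurable_fun setT (@chi R J k).
Proof. exact: has_int_measurable (has_int_chi R J k). Qed.

Lemma measurable_hpsi J k : measurable_fun setT (@hpsi R J k).
Proof.
apply: measurable_funM; first exact: measurable_cst.
by apply: measurable_funB; exact: measurable_chi.
Qed.

Lemma varphi_hpsi j k J k' : -1 <= j ->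
  has_int (fun x => varphi j k x * hpsi J k' x) ((j == J%:Z) && (k == k'))%:R.
Proof.
move=> j1; apply: (has_int_countable (@countable_dyadics R)); last first.
- exact: (@hvar_hvar R j k J k').
- by move=> x Dx; rewrite varphi_hvar.
by apply: measurable_funM; [exact: measurable_varphi|exact: measurable_hpsi].
Qed.

Lemma varphi_chi00 j k : -1 <= j ->
  has_int (fun x => varphi j k x * chi 0 0 x) ((j == -1) && (k == 0))%:R.
Proof.
move=> j1; apply: (has_int_countable (@countable_dyadics R)); last first.
- exact: (@hvar_hvar R j k (-1) 0).
- by move=> x Dx; rewrite varphi_hvar.
by apply: measurable_funM; [exact: measurable_varphi|exact: measurable_chi].
Qed.

Definition ftest J a x : R := chi 0 0 x + a * \sum_(k < 2 ^ J) hpsi J k x.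

Lemma measurable_ftest J a : measurable_fun setT (ftest J a).
Proof.
apply: measurable_funD; first exact: measurable_chi.
apply: measurable_funM; first exact: measurable_cst.
by apply: measurable_sum => k; exact: measurable_hpsi.
Qed.

Lemma has_int_mul_ftest g u J (v : 'I_(2 ^ J) -> R) a : has_int (fun x => g x * chi 0 0 x) u ->
  (forall k : 'I_(2 ^ J), has_int (fun x => g x * hpsi J k x) (v k)) ->
  has_int (fun x => g x * ftest J a x) (u + a * \sum_(k < 2 ^ J) v k).
Proof.
move=> gu gv.
have gs := @has_int_sum R _ (index_enum _) xpredT _ _ (fun i _ => gv i).
apply: has_int_ext (has_intD gu (has_intZ a gs)) _ => x.
by rewrite /ftest mulrDr [in RHS]mulrCA [in RHS](mulr_sumr (index_enum _)).
Qed.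

Definition haar_range J j k := (j == J%:Z) && (0 <= k < (2 ^ J)%:Z).

Lemma sum_haar_delta J j k :
  \sum_(k' < 2 ^ J) ((j == J%:Z) && (k == k'%:Z))%:R = (haar_range J j k)%:R :> R.
Proof.
rewrite /haar_range; case: eqP => [_|_]; last by rewrite big1.
case: (boolP (_ <= _ < _)) => /= hk.
  have kJ : (`|k| < 2 ^ J)%N by lia.
  rewrite (bigD1 (Ordinal kJ))//= big1 ?addr0.
    by rewrite (_ : k == _ = true)//; apply/eqP; lia.
  move=> i /eqP ik; rewrite (_ : k == _ = false)//; apply/negP => /eqP e.
  by apply: ik; apply: val_inj => /=; lia.
rewrite big1// => i _; rewrite (_ : k == _ = false)//; apply/negP => /eqP e.
by move/negP: hk; apply; rewrite e; have := ltn_ord i; lia.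
Qed.

Lemma varphi_ftest j k J a : -1 <= j ->
  has_int (fun x => varphi j k x * ftest J a x)
    (((j == -1) && (k == 0))%:R + a * (haar_range J j k)%:R).
Proof.
move=> j1; rewrite -sum_haar_delta; apply: has_int_mul_ftest => [|i].
  exact: varphi_chi00.
exact: varphi_hpsi.
Qed.

Lemma beta_ftest j k J a : -1 <= j ->
  beta (ftest J a) j k = ((j == -1) && (k == 0))%:R + a * (haar_range J j k)%:R.
Proof. by move=> j1; rewrite /beta (varphi_ftest k J a j1).2. Qed.

(** Wavelets of level [J] integrate to zero over a dyadic interval of that level, so the
    perturbation leaves its mass equal to its length. *)
Lemma chi_mul_ftest J a k : 0 <= k < (2 ^ J)%:Z ->
  has_int (fun x => chi J k x * ftest J a x) (2 ^- J).
Proof.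
move=> hk; have c0 : has_int (fun x => @chi R J k x * chi 0 0 x) (2 ^- J).
  apply: has_int_ext (has_int_chi R J k) _ => x.
  have := chi_mul 0 0 J k x; rewrite add0n divz_small; last first.
    have -> : 2 ^+ J = (2 ^ J)%N%:Z by rewrite -natz natrX.
    exact: hk.
  by rewrite eqxx mul1r mulrC => ->.
have := has_int_mul_ftest a c0 (fun i => @chi_hpsi R J k 0 i); rewrite addn0.
by apply: has_int_eq => //; rewrite big1// mulr0 addr0.
Qed.

(** Almost everywhere the squared wavelet is [2 ^+ J] times the indicator of an interval of mass
    [2 ^- J]; hence the variance [1 / n] of the empirical coefficient. *)
Lemma varphi_sq_ftest J a k : 0 <= k < (2 ^ J)%:Z ->
  has_int (fun x => varphi J k x ^+ 2 * ftest J a x) 1.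
Proof.
move=> hk; apply: (has_int_countable (@countable_dyadics R)); last first.
- have := has_intZ (2 ^+ J) (chi_mul_ftest a hk).
  by rewrite mulfV ?gt_eqF ?exprn_gt0//; exact.
- move=> x Dx; rewrite varphi_hvar// /hvar ltNge/= expr2 hpsi_mul eqxx mul1r.
  by rewrite mulrA.
apply: measurable_funM; last exact: measurable_ftest.
by apply: measurable_funX; exact: measurable_varphi.
Qed.

Lemma varphi00_sq_ftest J a :
  has_int (fun x => varphi (-1) 0 x ^+ 2 * ftest J a x) 1.
Proof.
have := @varphi_ftest (-1) 0 J a isT; apply: has_int_eq => [x|].
  by congr (_ * _); rewrite /varphi /haar_phi /=; case: ifP; rewrite ?expr1n ?expr0n.
by rewrite !eqxx /haar_range /= mulr0 addr0.
Qed.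

Lemma varphi_pow4 J k x : varphi J k x ^+ 4 = 2 ^+ J * varphi J k x ^+ 2.
Proof.
have psi4 y : haar_psi y ^+ 4 = haar_psi y ^+ 2 :> R.
  by rewrite /haar_psi; do 2?[case: ifP => _]; rewrite ?expr1n ?expr0n//; ring.
rewrite /varphi ltNge/= !exprMn psi4; set S := Num.sqrt _.
have <- : S ^+ 2 = 2 ^+ J by rewrite sqr_sqrtr ?exprn_ge0.
by ring.
Qed.

(** Level [-1] counts as 0, so that [2 ^+ haar_level j] is always the value of the squared Haar
    function on its support. *)
Definition haar_level j := if j < 0 then 0%N else `|j|%N.

Lemma varphi_sq_support j k x :
  varphi j k x ^+ 2 = 2 ^+ haar_level j * (varphi j k x != 0)%:R :> R.
Proof.
rewrite /varphi /haar_level; case: ifP => hj.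
  by rewrite /haar_phi expr0 mul1r; case: ifP; rewrite ?oner_eq0 ?eqxx ?expr1n ?expr0n.
have s0 : Num.sqrt (2 ^+ `|j|) != 0 :> R by rewrite sqrtr_eq0 -ltNge exprn_gt0.
rewrite exprMn sqr_sqrtr ?exprn_ge0// mulf_eq0 negb_or s0; congr (_ * _).
rewrite /haar_psi; do 2?[case: ifP => _];
  by rewrite ?oppr_eq0 ?sqrrN ?oner_eq0 ?eqxx ?expr1n ?expr0n.
Qed.

Lemma Fmass_of_sq j k (f : R -> R) v :
  has_int (fun x => varphi j k x ^+ 2 * f x) v ->
  Fmass f j k = (2 ^- haar_level j * v)%:E.
Proof.
move=> /(has_intZ (2 ^- haar_level j)) [_ <-].
rewrite /Fmass integral_mkcond; apply: eq_integral => x _.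
rewrite /patch varphi_sq_support !mulrA mulVf ?expf_neq0// mul1r.
rewrite mem_setE unfold_in /=.
by case: (varphi j k x != 0); rewrite ?mul1r ?mul0r.
Qed.

End HaarIntegrals.

(** * The loss dominates the killed coefficients *)

Section LossLowerBound.
Variable R : realType.
Implicit Types (x a : R) (j k : int) (J n M : nat) (s : seq R).

Lemma sumZ_finite (u : int -> R) M : (forall k, (M < `|k|)%N -> u k = 0) ->
  sumZ u = \sum_(i < M.*2.+1) u (i%:Z - M%:Z).
Proof.
move=> u0; rewrite /sumZ; apply: lim_near_cst => //.
exists M => // N /= MN; elim: N MN => [|N IH]; first by rewrite leqn0 => /eqP ->.
rewrite leq_eqVlt => /predU1P[-> //|]; rewrite ltnS => MN.
rewrite doubleS big_ord_recl big_ord_recr /= -[RHS](IH MN) /bump /=.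
rewrite u0; last by lia.
rewrite [X in _ + (_ + X)]u0; last by lia.
by rewrite add0r addr0; apply: eq_bigr => i _; congr (u _); lia.
Qed.

(** The rescaled point lies in [0, M] and the rescaled support is a unit interval starting at [k]; a
    single [M] can then serve every level of the estimator. *)
Lemma varphi_eq0 j k x M : 0 <= x < 1 -> 2 ^+ haar_level j <= M%:R :> R ->
  (M < `|k|)%N -> varphi j k x = 0.
Proof.
move=> /andP[x0 x1] jM Mk.
have kM : (k%:~R <= - (M.+1%:R) :> R) \/ (M.+1%:R <= k%:~R :> R).
  have [k0|k0] := leP 0 k.
    by right; rewrite -[M.+1%:R]/(M.+1%:Z%:~R) ler_int; lia.
  by left; rewrite -[M.+1%:R]/(M.+1%:Z%:~R) -mulrNz ler_int; lia.
rewrite -natr1 {Mk} in kM; have M0 : 0 <= M%:R :> R by [].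
move: jM; rewrite /varphi /haar_level; case: ifP => _ jM.
  rewrite /haar_phi; case: ifP => // h; exfalso.
  by rewrite expr0 in jM; case: kM => kM; lra.
have M1 : 1 <= M%:R :> R by apply: le_trans jM; rewrite exprn_ege1// ler1n.
have y0 : 0 <= 2 ^+ `|j| * x by rewrite mulr_ge0 ?exprn_ge0.
have yM : 2 ^+ `|j| * x < M%:R + 1.
  rewrite (@le_lt_trans _ _ (2 ^+ `|j|))//; last by lra.
  by rewrite ler_piMr ?exprn_ge0// ltW.
rewrite /haar_psi; case: ifP => h; first by exfalso; case: kM => kM; lra.
by case: ifP => h'; rewrite ?mulr0//; exfalso; case: kM => kM; lra.
Qed.

Lemma hpsi_eq0 J k x : 0 <= k < (2 ^ J)%:Z -> ~~ (0 <= x < 1) -> hpsi J k x = 0.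
Proof.
move=> /andP[k0 kJ] x01; rewrite /hpsi /chi !floor_eq.
have e : 2 ^+ J.+1 = 2 * (2 ^ J)%:Z%:~R :> R by rewrite exprS -natrX.
have k0' : 0 <= k%:~R :> R by rewrite ler0z.
have kJ' : k%:~R + 1 <= (2 ^ J)%:Z%:~R :> R.
  by rewrite -[1]/(1%:~R) -intrD ler_int; lia.
have P0 : 0 < 2 ^+ J.+1 :> R by rewrite exprn_gt0.
have n1 (b : int) : b = 0 \/ b = 1 ->
    ((2 * k + b)%:~R <= 2 ^+ J.+1 * x < (2 * k + b + 1)%:~R) = false.
  move=> b01; apply/negP => /andP[h1 h2]; move/negP: x01; apply.
  have [b0 b1] : 0 <= b%:~R :> R /\ b%:~R <= 1 :> R by case: b01 => ->.
  rewrite !intrD intrM -[2%:~R]/(2 : R) in h1 h2.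
  rewrite -(pmulr_rge0 _ P0) -[X in _ && X](ltr_pM2l P0) mulr1.
  by apply/andP; split; [|rewrite [X in _ < X]e]; lra.
have := n1 0 (or_introl erefl); rewrite addr0 => ->.
by rewrite n1 ?subrr ?mulr0//; right.
Qed.

Lemma f_tilde_unit_interval gamma n s x (c := fun j k => beta_hat n s j k *
      (if `|beta_hat n s j k| >= Defs.eta gamma n s j k then 1 else 0)) :
  0 <= x < 1 -> f_tilde gamma n s x =
  \sum_(i < (j0 n).+2) \sum_(l < (2 ^ j0 n).*2.+1)
    c (i%:Z - 1) (l%:Z - (2 ^ j0 n)%:Z) * varphi (i%:Z - 1) (l%:Z - (2 ^ j0 n)%:Z) x.
Proof.
move=> x01; rewrite /f_tilde /sum_Gamma; apply: eq_bigr => i _.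
apply: sumZ_finite => k hk; rewrite (varphi_eq0 _ _ hk) ?mulr0//.
rewrite natrX ler_eXn2l ?ltr1n// /haar_level; case: ifP => // hi.
by have := ltn_ord i; lia.
Qed.

Lemma sum_ord_delta (N m : nat) (F : int -> R) (d : int -> bool) :
  (m < N)%N -> (forall i : 'I_N, d i%:Z = (i == m :> nat)) ->
  \sum_(i < N) F i%:Z * (d i%:Z)%:R = F m%:Z.
Proof.
move=> mN dm; have /= dmm := dm (Ordinal mN).
rewrite (bigD1 (Ordinal mN))//= dmm eqxx mulr1 big1 ?addr0// => i /eqP im.
rewrite dm (_ : _ == _ = false) ?mulr0//; apply/negP => /eqP e; apply: im.
exact: val_inj.
Qed.

(** A Bessel-type bound: the estimator minus the intensity has coefficient [- a] on every killed
    wavelet of level [J], and these wavelets are orthonormal. *)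
Lemma loss_ftest_ge gamma n s J a : (J <= j0 n)%N ->
  ((\sum_(k < 2 ^ J) a ^+ 2 *
     (~~ (Defs.eta gamma n s J k <= `|beta_hat n s J k|))%:R)%:E
   <= loss gamma n (ftest J a) s)%E.
Proof.
move=> Jj0; set M := (2 ^ j0 n)%N.
pose c j k := beta_hat n s j k *
  (if Defs.eta gamma n s j k <= `|beta_hat n s j k| then 1 else 0).
pose b (k : 'I_(2 ^ J)) : R := (~~ (Defs.eta gamma n s J k <= `|beta_hat n s J k|))%:R.
pose G x := \sum_(i < (j0 n).+2) \sum_(l < M.*2.+1)
  c (i%:Z - 1) (l%:Z - M%:Z) * varphi (i%:Z - 1) (l%:Z - M%:Z) x.
(* The part of the error carried by the killed wavelets. *)
pose p x := \sum_(k < 2 ^ J) (- a * b k) * hpsi J k x.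
have leM : (2 ^ J <= M)%N by rewrite leq_exp2l.
have hG (k : 'I_(2 ^ J)) : has_int (fun x => G x * hpsi J k x) (c J k).
  have h1 (i : 'I_(j0 n).+2) (l : 'I_M.*2.+1) := has_intZ (c (i%:Z - 1) (l%:Z - M%:Z))
    (@varphi_hpsi R (i%:Z - 1) (l%:Z - M%:Z) J k ltac:(lia)).
  have h2 i := @has_int_sum R _ (index_enum _) xpredT _ _ (fun l _ => h1 i l).
  have := @has_int_sum R _ (index_enum _) xpredT _ _ (fun i _ => h2 i).
  apply: has_int_eq => [x|].
    rewrite /G mulr_suml; apply: eq_bigr => i _; rewrite mulr_suml.
    by apply: eq_bigr => l _; rewrite mulrA.
  have kM := leq_trans (ltn_ord k) leM.
  transitivity (\sum_(i < (j0 n).+2) c (i%:Z - 1) k * (i%:Z - 1 == J%:Z)%:R).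
    apply: eq_bigr => i _; case: eqP => _ /=; last by rewrite mulr0 big1// => l _; rewrite mulr0.
    rewrite (@sum_ord_delta _ (k + M)%N (fun l => c (i%:Z - 1) (l - M%:Z))
      (fun l => l - M%:Z == k%:Z)).
    - by rewrite mulr1; congr (c _ _); lia.
    - by lia.
    - by move=> l; apply/eqP/eqP; lia.
  rewrite (@sum_ord_delta _ J.+1 (fun i => c (i - 1) k) (fun i => i - 1 == J%:Z)).
  - by congr (c _ _); lia.
  - by lia.
  - by move=> l; apply/eqP/eqP; lia.
have hf (k : 'I_(2 ^ J)) : has_int (fun x => ftest J a x * hpsi J k x) a.
  have h0 : has_int (fun x => @hpsi R J k x * chi 0 0 x) 0.
    by apply: has_int_ext (@chi_hpsi R 0 0 J k) _ => x; rewrite mulrC.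
  have := has_int_mul_ftest a h0 (fun i => @hpsi_hpsi R J k J i).
  apply: has_int_eq => [x|]; first by rewrite mulrC.
  rewrite add0r -[RHS]mulr1; congr (_ * _).
  have := @sum_haar_delta R J J k; rewrite /haar_range !eqxx /= => ->.
  by rewrite (_ : (_ < _) = true)//; have := ltn_ord k; lia.
have hp (k : 'I_(2 ^ J)) : has_int (fun x => p x * hpsi J k x) (- a * b k).
  have h (i : 'I_(2 ^ J)) := has_intZ (- a * b i) (@hpsi_hpsi R J i J k).
  have := @has_int_sum R _ (index_enum _) xpredT _ _ (fun i _ => h i).
  apply: has_int_eq => [x|].
    by rewrite /p mulr_suml; apply: eq_bigr => i _; rewrite mulrA.
  rewrite (bigD1 k)//= !eqxx mulr1 big1 ?addr0// => i /eqP ik.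
  rewrite (_ : i%:Z == _ = false) ?andbF ?mulr0//; apply/negP => /eqP e.
  by apply: ik; apply: val_inj => /=; lia.
(* With [D := G - ftest J a], expanding [(D - p) ^+ 2 >= 0] gives [(2 * D - p) * p <= D ^+ 2]. The
   left side is linear in [D], so orthonormality yields its integral. *)
have hr : has_int (fun x => (2 * (G x - ftest J a x) - p x) * p x)
    (\sum_(k < 2 ^ J) a ^+ 2 * b k).
  have h (k : 'I_(2 ^ J)) := has_intZ (- a * b k)
    (has_intB (has_intZ 2 (has_intB (hG k) (hf k))) (hp k)).
  have := @has_int_sum R _ (index_enum _) xpredT _ _ (fun i _ => h i).
  apply: has_int_eq => [x|].
    by rewrite [X in _ = _ * X]/p mulr_sumr; apply: eq_bigr => i _; ring.
  by apply: eq_bigr => k _; rewrite /c /b; case: ifP => _ /=; ring.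
apply: (has_int_le_integral hr) => x; first by rewrite lee_fin sqr_ge0.
rewrite lee_fin; have [x01|x01] := boolP (0 <= x < 1).
  rewrite (f_tilde_unit_interval _ _ _ x01) -/M -/(G x).
  by have := sqr_ge0 (G x - ftest J a x - p x); lra.
(* Outside [0, 1) [G] may differ from the estimator, but there the minorant vanishes with [p]. *)
have -> : p x = 0.
  rewrite /p big1// => k _; rewrite hpsi_eq0 ?mulr0//.
  by have := ltn_ord k; lia.
by rewrite mulr0 sqr_ge0.
Qed.

End LossLowerBound.

(** * Membership in the class and oracle term *)

Section TestFunction.
Variable R : realType.
Implicit Types (x a c : R) (j k : int) (J n : nat).

(** At each point at most one wavelet of the level is nonzero. *)
Lemma sum_hpsi_sq J x : (\sum_(k < 2 ^ J) hpsi J k x) ^+ 2 <= 2 ^+ J :> R.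
Proof.
rewrite expr2 mulr_suml.
apply: (@le_trans _ _ (\sum_(k < 2 ^ J) 2 ^+ J * (Num.floor (2 ^+ J * x) == k%:Z)%:R)).
  apply: ler_sum => i _; rewrite mulr_sumr (bigD1 i)//= big1 ?addr0.
    by rewrite hpsi_mul eqxx mul1r.
  move=> k /eqP ki; rewrite hpsi_mul (_ : i%:Z == _ = false) ?mul0r//.
  by apply/negP => /eqP e; apply: ki; apply: val_inj => /=; lia.
rewrite -mulr_sumr ler_piMr ?exprn_ge0//.
have := @sum_haar_delta R J J (Num.floor (2 ^+ J * x)); rewrite eqxx /= => ->.
by case: (haar_range _ _ _).
Qed.

Lemma chi00E x : chi 0 0 x = (0 <= x < 1)%R%:R :> R.
Proof. by rewrite /chi floor_eq expr0 mul1r add0r. Qed.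

(** The perturbation is at most 1 in absolute value, so the intensity stays between 0 and 2 on [0,
    1); this is what a radius of at least 2 accommodates. *)
Lemma ftest_bound J a x : a ^+ 2 * 2 ^+ J <= 1 ->
  0 <= ftest J a x <= 2 * chi 0 0 x.
Proof.
move=> aJ; rewrite /ftest chi00E; case: (boolP (0 <= x < 1)) => x01 /=.
  have : (a * \sum_(k < 2 ^ J) hpsi J k x) ^+ 2 <= 1.
    rewrite exprMn; apply: le_trans aJ; rewrite ler_wpM2l ?sqr_ge0//.
    exact: sum_hpsi_sq.
  by move: (a * _) => y; nra.
rewrite big1 ?mulr0 ?addr0 ?lexx// => k _; rewrite hpsi_eq0//.
by have := ltn_ord k; lia.
Qed.

Lemma has_int_ftest J a : has_int (ftest J a) 1.
Proof.
have c0 : has_int (fun x => 1 * @chi R 0 0 x) 1.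
  have := has_int_chi R 0 0; apply: has_int_eq => [x|]; first by rewrite mul1r.
  by rewrite expr0 invr1.
have h0 (i : 'I_(2 ^ J)) : has_int (fun x => 1 * @hpsi R J i x) 0.
  have := has_intZ (Num.sqrt (2 ^+ J)) (has_intB (has_int_chi R J.+1 (2 * i%:Z))
     (has_int_chi R J.+1 (2 * i%:Z + 1))).
  by apply: has_int_eq => [x|]; rewrite ?mul1r ?subrr ?mulr0.
have := has_int_mul_ftest a c0 h0; apply: has_int_eq => [x|]; first by rewrite mul1r.
by rewrite big1// mulr0 addr0.
Qed.

Lemma Fmass_ge0 (f : R -> R) j k : (forall x, 0 <= f x) -> (0 <= Fmass f j k)%E.
Proof. by move=> f0; apply: integral_ge0 => x _; rewrite lee_fin. Qed.

(** The norms come from the total mass 1 and the bound 2 on the unit interval. Nonzero coefficients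
    live on supports of mass 1 or [2 ^- J]. *)
Lemma ftest_Fclass n (R0 : R) J a : 2 <= R0 -> a ^+ 2 * 2 ^+ J <= 1 ->
  ln n%:R * ln (ln n%:R) / n%:R <= 2 ^- J :> R -> Fclass n R0 (ftest J a).
Proof.
move=> R2 aJ thr.
have f0 x : 0 <= ftest J a x by have /andP[] := ftest_bound x aJ.
have f2 x : ftest J a x <= 2 * chi 0 0 x by have /andP[] := ftest_bound x aJ.
have [intf intf1] := has_int_ftest J a.
split; first exact: measurable_ftest.
split=> //; split; last split; last split.
- rewrite Lnorm1 (_ : (fun x => _) = fun x => (ftest J a x)%:E).
    by rewrite intf1 lee_fin; lra.
  by apply/funext => x; rewrite gee0_abs// lee_fin.
- rewrite unlock (_ : (fun x => _) = fun x => (ftest J a x ^+ 2)%:E); last first.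
    by apply/funext => x; rewrite gee0_abs ?lee_fin// poweR_EFin powR_mulrn.
  have le4 : (\int[@leb R]_x (ftest J a x ^+ 2)%:E <= (R0 ^+ 2)%:E)%E.
    apply: (@le_trans _ _ (\int[@leb R]_x (R0 ^+ 2 * chi 0 0 x)%:E)%E); last first.
      by rewrite (has_intZ (R0 ^+ 2) (has_int_chi R 0 0)).2 expr0 invr1 mulr1.
    apply: nonneg_le_integral => x; rewrite lee_fin ?sqr_ge0//.
    have := f2 x; have := f0 x; rewrite chi00E; case: (_ <= _ < _) => /=; nra.
  rewrite poweR12_sqrt ?integral_ge0//; last by move=> x _; rewrite lee_fin sqr_ge0.
  have -> : R0%:E = sqrte (R0 ^+ 2)%:E by rewrite /= sqrtr_sqr ger0_norm//; lra.
  by rewrite lee_sqrt// lee_fin sqr_ge0.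
- rewrite unlock /=; case: ifP => _; last by rewrite lee_fin; lra.
  apply/ess_supP; apply: nearW => x /=; rewrite lee_fin ger0_norm//.
  by have := f2 x; rewrite chi00E; case: (_ <= _ < _) => /=; lra.
- move=> j k j1; have [b0|b0] := eqVneq (beta (ftest J a) j k) 0.
    by rewrite mulr0 Fmass_ge0.
  rewrite mulr1.
  have J1 : 2 ^- J <= 1 :> R by rewrite invf_le1 ?exprn_gt0// exprn_ege1// ler1n.
  move: b0; rewrite beta_ftest//.
  case: (boolP ((j == -1) && (k == 0))) => [/andP[/eqP -> /eqP ->] _|_].
    rewrite (Fmass_of_sq (varphi00_sq_ftest J a)) lee_fin expr0 invr1 mulr1.
    exact: le_trans thr J1.
  rewrite add0r; case: (boolP (haar_range J j k)) => [/andP[/eqP -> hk] _|_]; last first.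
    by rewrite mulr0 eqxx.
  by rewrite (Fmass_of_sq (varphi_sq_ftest a hk)) lee_fin mulr1.
Qed.

(** A member of the class for every [n], which makes the supremum nonnegative when [n] is too small
    for the test intensity. *)
Lemma cst0_Fclass n (R0 : R) : 2 <= R0 -> Fclass n R0 (fun=> 0 : R).
Proof.
move=> R2; have R0' : (0 <= R0%:E)%E by rewrite lee_fin; lra.
have L0 p : p != 0%E -> (Lnorm (@leb R) p (fun=> 0%:E) <= R0%:E)%E.
  by move=> p0; rewrite Lnorm0.
do 2!split=> //; split; first exact: L0.
split; first by apply: L0; rewrite eqe pnatr_eq0.
split; first exact: L0.
move=> j k _; rewrite (_ : beta _ _ _ = 0); first by rewrite eqxx mulr0 Fmass_ge0.
by rewrite /beta; under eq_integral do rewrite mulr0; rewrite integral0.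
Qed.

Lemma esum_delta c k0 : 0 <= c ->
  (\esum_(k in [set: int]) (c * (k == k0)%:R)%:E = c%:E)%E.
Proof.
move=> c0; rewrite -(@esum_set1 _ _ k0 (fun=> c%:E)) ?lee_fin// [RHS]esum_mkcond.
apply: eq_esum => k _; rewrite (_ : (k \in [set k0]) = (k == k0)).
  by case: eqP => _; rewrite ?mulr1 ?mulr0.
by apply/idP/idP; rewrite inE /= => /eqP.
Qed.

Lemma oracle_term_ftest n J a j k : -1 <= j ->
  Num.min (beta (ftest J a) j k ^+ 2) (Vn n (ftest J a) j k) <=
  n%:R^-1 * ((j == -1) && (k == 0))%:R + n%:R^-1 * (haar_range J j k)%:R.
Proof.
move=> j1; rewrite beta_ftest// ge_min.
have n0 : 0 <= n%:R^-1 :> R by rewrite invr_ge0.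
case: (boolP ((j == -1) && (k == 0))) => [/andP[/eqP -> /eqP ->]|_].
  rewrite /Vn (varphi00_sq_ftest J a).2 /= mulr1; apply/orP; right.
  by rewrite lerDl mulr_ge0.
case: (boolP (haar_range J j k)) => [/andP[/eqP -> hk]|_].
  by apply/orP; right; rewrite /Vn (varphi_sq_ftest a hk).2 /=; lra.
by rewrite !mulr0 addr0 expr0n lexx.
Qed.

Lemma oracle_ftest n J a : (J <= j0 n)%N ->
  (esum_Gamma n (fun j k => (Num.min (beta (ftest J a) j k ^+ 2)
                                     (Vn n (ftest J a) j k))%:E)
   <= (n%:R^-1 * (1 + 2 ^+ J))%:E)%E.
Proof.
move=> Jn; have n0 : 0 <= n%:R^-1 :> R by rewrite invr_ge0.
(* The bound is spread over the levels, [1 / n] at level [-1] and [2 ^+ J / n] at level [J]; the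
   index [i] stands for level [i - 1]. *)
have -> : n%:R^-1 * (1 + 2 ^+ J) = \sum_(i < (j0 n).+2)
   (n%:R^-1 * (i%:Z - 1 == -1)%:R + n%:R^-1 * 2 ^+ J * (i%:Z - 1 == J%:Z)%:R) :> R.
  rewrite big_split /= (@sum_ord_delta R _ 0 (fun=> n%:R^-1) (fun i => i - 1 == -1))//.
    rewrite (@sum_ord_delta R _ J.+1 (fun=> n%:R^-1 * 2 ^+ J) (fun i => i - 1 == J%:Z)).
    - by ring.
    - by lia.
    - by move=> l; apply/eqP/eqP; lia.
  by move=> l; apply/eqP/eqP; lia.
rewrite /esum_Gamma -sumEFin; apply: lee_sum => i _.
set j := i%:Z - 1; have j1 : -1 <= j by lia.
apply: (@le_trans _ _ (\esum_(k in [set: int])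
   ((n%:R^-1 * (j == -1)%:R * (k == 0)%:R)%:E +
    \sum_(k' < 2 ^ J) (n%:R^-1 * (j == J%:Z)%:R * (k == k'%:Z)%:R)%:E)))%E.
  apply: le_esum => k _; rewrite sumEFin -EFinD lee_fin.
  apply: le_trans (oracle_term_ftest n J a k j1) _; apply: lerD.
    by rewrite -mulrA -natrM mulnb.
  rewrite -sum_haar_delta mulr_sumr; apply: ler_sum => k' _.
  by rewrite -mulrA -natrM mulnb.
rewrite esumD; first last.
- by move=> k _; apply: sume_ge0 => k' _; rewrite lee_fin !mulr_ge0.
- by move=> k _; rewrite lee_fin !mulr_ge0.
rewrite esum_delta ?mulr_ge0// esum_sum; last first.
  by move=> k k' _ _; rewrite lee_fin !mulr_ge0.
under eq_bigr do rewrite esum_delta ?mulr_ge0//.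
rewrite sumEFin -EFinD lee_fin lerD2l sumr_const card_ord -[leLHS]mulr_natr natrX.
by rewrite mulrAC.
Qed.

End TestFunction.

(** * Chebyshev bound on kept coefficients *)

Section RiskLowerBound.
Variable R : realType.
Implicit Types (x a gamma gm L N : R) (j k : int) (J n : nat) (s : seq R).

Lemma varphi_sup_ge0 j k : 0 <= @varphi_sup R j k.
Proof.
rewrite /varphi_sup.
have [hs|/sup_out -> //] := pselect (has_sup [set `|@varphi R j k x| | x in [set: R]]).
apply: (@le_trans _ _ `|@varphi R j k 0|) => //.
by apply: (sup_upper_bound hs); exists 0.
Qed.

(** The threshold is at least [sqrt (2 * gamma * V_hat * ln n)], its corrections being nonnegative;
    squaring and multiplying by [n ^+ 2] removes the normalisations. *)
Lemma kept_ratio gamma n s j k : 0 <= gamma -> (0 < n)%N ->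
  Defs.eta gamma n s j k <= `|beta_hat n s j k| ->
  2 * gamma * ln n%:R * (\sum_(T <- s) varphi j k T ^+ 2)
    <= (\sum_(T <- s) varphi j k T) ^+ 2.
Proof.
move=> g0 n0 kept; have n1 : 0 < n%:R :> R by rewrite ltr0n.
have L0 : 0 <= ln (n%:R : R) by rewrite ln_ge0// ler1n.
have V0 : 0 <= V_hat n s j k :> R.
  by rewrite /V_hat mulr_ge0 ?invr_ge0 ?sqr_ge0// sumr_ge0// => T _; rewrite sqr_ge0.
have VV : V_hat n s j k <= V_tilde gamma n s j k.
  rewrite /V_tilde -addrA lerDl addr_ge0// ?sqrtr_ge0//.
  by apply: mulr_ge0; [rewrite !mulr_ge0|rewrite divr_ge0 ?sqr_ge0].
have h0 : 0 <= 2 * gamma * V_hat n s j k * ln n%:R.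
  by apply: mulr_ge0 => //; apply: mulr_ge0 => //; exact: mulr_ge0.
have : Num.sqrt (2 * gamma * V_hat n s j k * ln n%:R) <= `|beta_hat n s j k|.
  apply: le_trans kept.
  apply: (@le_trans _ _ (Num.sqrt (2 * gamma * V_tilde gamma n s j k * ln n%:R))).
    by apply: ler_wsqrtr; rewrite ler_wpM2r// ler_wpM2l// mulr_ge0.
  rewrite /Defs.eta lerDl; apply: mulr_ge0; last exact: varphi_sup_ge0.
  by rewrite divr_ge0 ?mulr_ge0.
rewrite -(@ler_pXn2r _ 2)// ?nnegrE ?sqrtr_ge0// sqr_sqrtr// real_normK ?num_real//.
rewrite /beta_hat /V_hat exprMn exprVn; set S1 := \sum_(T <- s) _; set S2 := \sum_(T <- s) _.
rewrite -(ler_pM2l (exprn_gt0 2 n1)).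
rewrite [leRHS]mulrA mulfV ?gt_eqF ?exprn_gt0// mul1r; apply: le_trans.
rewrite le_eqVlt; apply/orP; left; apply/eqP; field.
by rewrite gt_eqF.
Qed.

(* If [S2 >= (1 - delta) N] with [delta = h / (2 g)], then the ratio condition
   forces [|S1| >= w (g - h / 2)], at distance [w h / 2] of [w (g - h)]. *)
Lemma kept_chebyshev (g h : R) L N S1 S2 : 0 < h -> h < g -> 0 < L -> 0 < N ->
  2 * g ^+ 2 * L * S2 <= S1 ^+ 2 ->
  1 <= 2 / (L * N * h ^+ 2) * (S1 - (g - h) * Num.sqrt (2 * L * N)) ^+ 2
       + (2 * g / (h * N)) ^+ 2 * (S2 - N) ^+ 2.
Proof.
move=> h0 hg L0 N0 rat; have g0 := lt_trans h0 hg.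
set w := Num.sqrt _; have w2 : w ^+ 2 = 2 * L * N by rewrite sqr_sqrtr// !mulr_ge0// ltW.
have w0 : 0 < w by rewrite sqrtr_gt0 !mulr_gt0.
have A0 : 0 < L * N * h ^+ 2 by rewrite !mulr_gt0// exprn_gt0.
have B0 : 0 < (h * N) by rewrite mulr_gt0.
have t1 : 0 <= 2 / (L * N * h ^+ 2) * (S1 - (g - h) * w) ^+ 2.
  by rewrite mulr_ge0 ?sqr_ge0// divr_ge0// ltW.
have t2 : 0 <= (2 * g / (h * N)) ^+ 2 * (S2 - N) ^+ 2 by rewrite mulr_ge0 ?sqr_ge0.
(* Either [S2] is far from [N] and the second term alone reaches 1, or it is close and the first
   term must. *)
have [far|near] := leP ((h * N) ^+ 2) ((2 * g * (S2 - N)) ^+ 2).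
  suff : 1 <= (2 * g / (h * N)) ^+ 2 * (S2 - N) ^+ 2 by lra.
  have -> : (2 * g / (h * N)) ^+ 2 * (S2 - N) ^+ 2 = (2 * g * (S2 - N)) ^+ 2 / (h * N) ^+ 2.
    by field; rewrite ?gt_eqF.
  by rewrite ler_pdivlMr ?exprn_gt0// mul1r.
suff : 1 <= 2 / (L * N * h ^+ 2) * (S1 - (g - h) * w) ^+ 2 by lra.
have -> : 2 / (L * N * h ^+ 2) * (S1 - (g - h) * w) ^+ 2 =
          (2 * (S1 - (g - h) * w)) ^+ 2 / (h * w) ^+ 2.
  by rewrite [(h * w) ^+ 2]exprMn w2; field; rewrite ?gt_eqF.
rewrite ler_pdivlMr ?exprn_gt0 ?mulr_gt0// mul1r leNgt; apply/negP => close.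
have hw : 0 < h * w by rewrite mulr_gt0.
have [c1 c2] : - (h * w) < 2 * (S1 - (g - h) * w) /\ 2 * (S1 - (g - h) * w) < h * w.
  by move: close hw; move: (2 * _) (h * w) => y z *; split; nra.
have [s1 s2] : - (h * N) < 2 * g * (S2 - N) /\ 2 * g * (S2 - N) < h * N.
  by move: near B0; move: (2 * g * _) (h * N) => y z *; split; nra.
have gw : h * w < g * w by rewrite ltr_pM2r.
have b1 : 2 * S1 < (2 * g - h) * w by lra.
have b2 : - ((2 * g - h) * w) < 2 * S1 by lra.
have up : 4 * S1 ^+ 2 < (2 * g - h) ^+ 2 * (2 * L * N).
  rewrite -w2 -exprMn (_ : 4 * S1 ^+ 2 = (2 * S1) ^+ 2); last by ring.
  by move: b1 b2; move: (2 * S1) (_ * w) => y z *; nra.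
have lo : (2 * g - h) * N < 2 * g * S2 by lra.
have lo' : 4 * g * L * ((2 * g - h) * N) < 4 * g * L * (2 * g * S2).
  by rewrite ltr_pM2l// !mulr_gt0.
have LN : 0 < L * N by rewrite mulr_gt0.
(* As [0 < h < g], this chains [up] and [lo'] into [4 * S1 ^+ 2 < 8 * g ^+ 2 * L * S2], against
   [rat]. *)
have key : (2 * g - h) ^+ 2 * (2 * L * N) <= 4 * g * L * ((2 * g - h) * N).
  have -> : 4 * g * L * ((2 * g - h) * N) = (2 * g) * (2 * g - h) * (2 * L * N) by ring.
  by rewrite ler_wpM2r; [| |nra]; rewrite ?mulr_ge0 ?ltW//.
have e : 4 * g * L * (2 * g * S2) = 4 * (2 * g ^+ 2 * L * S2) by ring.
lra.
Qed.

Lemma poisson_risk_ge gamma gm n J (L := ln n%:R)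
    (a := (Num.sqrt gamma - Num.sqrt gm) * Num.sqrt (2 * L / n%:R)) :
  0 < gm -> gm < gamma -> (1 < n)%N -> (J <= j0 n)%N -> a ^+ 2 * 2 ^+ J <= 1 ->
  ((2 ^+ J * (a ^+ 2 * (1 - (2 / (L * gm) + 4 * gamma / gm * (2 ^+ J / n%:R)))))%:E
    <= poisson_exp (fun t => (n%:R * ftest J a t)%R) (loss gamma n (ftest J a)))%E.
Proof.
move=> gm0 gmg n1 Jn aJ; set g := Num.sqrt gamma; set h := Num.sqrt gm.
have gamma0 : 0 < gamma := lt_trans gm0 gmg.
have h0 : 0 < h by rewrite sqrtr_gt0.
have hg : h < g by rewrite ltr_sqrt.
have g2 : g ^+ 2 = gamma by rewrite sqr_sqrtr// ltW.
have h2 : h ^+ 2 = gm by rewrite sqr_sqrtr// ltW.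
have N0 : 0 < n%:R :> R by rewrite ltr0n (ltn_trans _ n1).
have L0 : 0 < L by rewrite ln_gt0// ltr1n.
(* The mean of the sum of [varphi J k] over the points, in the form of the centre in
   [kept_chebyshev]. *)
have na : n%:R * a = (g - h) * Num.sqrt (2 * L * n%:R).
  rewrite /a mulrCA; congr (_ * _).
  rewrite -{1}(ger0_norm (ltW N0)) -sqrtr_sqr -sqrtrM ?sqr_ge0//.
  by congr Num.sqrt; field; rewrite gt_eqF.
pose nu t := n%:R * ftest J a t.
have nuE f u : has_int (fun t => f t * ftest J a t) u ->
    has_int (fun t => nu t * f t) (n%:R * u).
  by move=> fu; apply: has_int_ext (has_intZ n%:R fu) _ => t; rewrite /nu; ring.
have num : has_int nu n%:R.
  by have := has_intZ n%:R (has_int_ftest J a); rewrite mulr1.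
pose A := 2 / (L * n%:R * h ^+ 2); pose B := (2 * g / (h * n%:R)) ^+ 2.
(* A minorant of [a ^+ 2] times the indicator of a killed coefficient: never above [a ^+ 2], and at
   most 0 for a kept one by [kept_chebyshev]. *)
pose P (k : 'I_(2 ^ J)) s := a ^+ 2 * (1 - (A * (\sum_(T <- s) varphi J k T - n%:R * a) ^+ 2
   + B * (\sum_(T <- s) varphi J k T ^+ 2 - n%:R) ^+ 2)).
have kJ (k : 'I_(2 ^ J)) : 0 <= k%:Z < (2 ^ J)%:Z by have := ltn_ord k; lia.
have Pv (k : 'I_(2 ^ J)) : poisson_val nu (P k)
    (a ^+ 2 * (1 - (2 / (L * gm) + 4 * gamma / gm * (2 ^+ J / n%:R)))).
  have v1 : has_int (fun t => nu t * varphi J k t) (n%:R * a).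
    have := nuE _ _ (@varphi_ftest R J k J a isT).
    by rewrite /haar_range eqxx kJ /= add0r mulr1.
  have v2 : has_int (fun t => nu t * varphi J k t ^+ 2) n%:R.
    by have := nuE _ _ (varphi_sq_ftest a (kJ k)); rewrite mulr1.
  have v4 : has_int (fun t => nu t * (varphi J k t ^+ 2) ^+ 2) (2 ^+ J * n%:R).
    apply: has_int_ext (has_intZ (2 ^+ J) v2) _ => t.
    by rewrite -exprM varphi_pow4 mulrCA.
  have := poisson_valZ (a ^+ 2) (poisson_valD (poisson_val_cst 1 num)
    (poisson_valZ (-1) (poisson_valD
      (poisson_valZ A (poisson_val_sq (n%:R * a) num v1 v2))
      (poisson_valZ B (poisson_val_sq n%:R num v2 v4))))).
  rewrite !subrr expr0n /= !add0r.
  (* [A] multiplies the variance [n] of the sum, [B] the variance [2 ^+ J * n] of the sum of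
     squares. *)
  have -> : 1 + -1 * (A * n%:R + B * (2 ^+ J * n%:R)) =
      1 - (2 / (L * gm) + 4 * gamma / gm * (2 ^+ J / n%:R)).
    by rewrite /A /B -g2 -h2; field; rewrite ?gt_eqF.
  by apply: poisson_val_ext => s; rewrite /P mulN1r.
have := poisson_val_sum (index_enum _) num Pv.
rewrite sumr_const card_ord -[X in poisson_val _ _ X]mulr_natl natrX.
apply: poisson_val_le => [t|s|s].
- by rewrite mulr_ge0//; have /andP[] := ftest_bound t aJ.
- by apply: integral_ge0 => x _; rewrite lee_fin sqr_ge0.
apply: le_trans (loss_ftest_ge _ _ _ Jn).
rewrite lee_fin; apply: ler_sum => k _; rewrite /P ler_wpM2l ?sqr_ge0//.
case: (boolP (Defs.eta _ _ _ _ _ <= _)) => [kept|_] /=; last first.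
  by rewrite gerBl addr_ge0// mulr_ge0 ?sqr_ge0// /A divr_ge0// !mulr_ge0// ltW.
have := kept_ratio (ltW gamma0) (ltnW n1) kept; rewrite -g2 => rat.
have := kept_chebyshev h0 hg L0 N0 rat; rewrite -na -/A -/B.
by rewrite subr_le0.
Qed.

End RiskLowerBound.

(** * Asymptotics *)

Section Asymptotics.
Variable R : realType.
Implicit Types (gamma gm : R) (n J : nat).

Lemma poisson_exp_ge0 (nu : R -> R) (G : seq R -> \bar R) :
  (forall t, 0 <= nu t) -> (forall s, 0 <= G s)%E -> (0 <= poisson_exp nu G)%E.
Proof.
move=> nu0 G0; apply: nneseries_ge0 => k _ _.
by rewrite mule_ge0 ?iter_int_ge0// lee_fin divr_ge0 ?expR_ge0.
Qed.

Lemma loss_ge0 gamma n (f : R -> R) s : (0 <= loss gamma n f s)%E.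
Proof. by apply: integral_ge0 => x _; rewrite lee_fin sqr_ge0. Qed.

Lemma oracle_ge0 n (f : R -> R) : (forall x, 0 <= f x) ->
  (0 <= esum_Gamma n (fun j k => (Num.min (beta f j k ^+ 2) (Vn n f j k))%:E))%E.
Proof.
move=> f0; apply: sume_ge0 => i _; apply: esum_ge0 => k _.
rewrite lee_fin le_min sqr_ge0 /Vn mulr_ge0 ?invr_ge0// fine_ge0// integral_ge0// => x _.
by rewrite lee_fin mulr_ge0 ?sqr_ge0.
Qed.

Lemma risk_ratio_ge0 gamma n (f : R -> R) : (forall x, 0 <= f x) ->
  (0 <= risk_ratio gamma n f)%E.
Proof.
move=> f0; rewrite /risk_ratio mule_ge0//.
  by apply: poisson_exp_ge0 => [t|s]; rewrite ?mulr_ge0 ?loss_ge0.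
by rewrite inve_ge0 adde_ge0 ?oracle_ge0// lee_fin invr_ge0.
Qed.

(** The denominator is at most [(2 ^+ J + 2) / n], counting the wavelets, [phi_0] and the added
    [1 / n]; the main factor is [n * a ^+ 2]. *)
Lemma risk_ratio_ftest_ge gamma gm n J (L := ln n%:R)
    (a := (Num.sqrt gamma - Num.sqrt gm) * Num.sqrt (2 * L / n%:R)) :
  0 < gm -> gm < gamma -> (1 < n)%N -> (J <= j0 n)%N -> a ^+ 2 * 2 ^+ J <= 1 ->
  ((2 * (Num.sqrt gamma - Num.sqrt gm) ^+ 2 * L
     * ((1 - (2 / (L * gm) + 4 * gamma / gm * (2 ^+ J / n%:R)))
        * (2 ^+ J / (2 ^+ J + 2))))%:E <= risk_ratio gamma n (ftest J a))%E.
Proof.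
move=> gm0 gmg n1 Jn aJ.
have N0 : 0 < n%:R :> R by rewrite ltr0n (ltn_trans _ n1).
have L0 : 0 < L by rewrite ln_gt0// ltr1n.
have f0 x : 0 <= ftest J a x by have /andP[] := ftest_bound x aJ.
have P0 : 0 < 2 ^+ J :> R by rewrite exprn_gt0.
have a2 : a ^+ 2 = (Num.sqrt gamma - Num.sqrt gm) ^+ 2 * (2 * L / n%:R).
  by rewrite exprMn sqr_sqrtr// divr_ge0 ?mulr_ge0// ltW.
have num := poisson_risk_ge gm0 gmg n1 Jn aJ.
set q := 2 / (L * gm) + _ in num *.
(* Multiplying the two lower bounds requires nonnegative ones; if [1 - q] is negative the claim is
   trivial. *)
have [q1|q1] := leP 0 (1 - q); last first.
  apply: le_trans (risk_ratio_ge0 _ _ f0); rewrite lee_fin.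
  apply: mulr_ge0_le0.
    by apply: mulr_ge0; [apply: mulr_ge0 => //; exact: sqr_ge0|exact: ltW].
  apply: mulr_le0_ge0; first exact: ltW.
  by rewrite divr_ge0 ?addr_ge0 ?exprn_ge0.
have -> : 2 * (Num.sqrt gamma - Num.sqrt gm) ^+ 2 * L * ((1 - q) * (2 ^+ J / (2 ^+ J + 2)))
    = 2 ^+ J * (a ^+ 2 * (1 - q)) * (n%:R^-1 * (2 ^+ J + 2))^-1.
  by rewrite a2; field; rewrite !gt_eqF//; rewrite addr_gt0.
have D0 : 0 < n%:R^-1 * (2 ^+ J + 2) :> R by rewrite mulr_gt0 ?invr_gt0 ?addr_gt0.
rewrite EFinM /risk_ratio; apply: lee_pmul; last 2 first.
- exact: num.
- have -> : ((n%:R^-1 * (2 ^+ J + 2))^-1)%:E = ((n%:R^-1 * (2 ^+ J + 2))%:E^-1)%E :> \bar R.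
    by rewrite inver gt_eqF.
  have n'0 : (0 <= (n%:R^-1 : R)%:E)%E by rewrite lee_fin invr_ge0.
  rewrite lee_pV2 ?inE ?adde_ge0 ?oracle_ge0 ?lee_fin ?(ltW D0)//.
  have -> : ((n%:R^-1 * (2 ^+ J + 2))%:E = (n%:R^-1 * (1 + 2 ^+ J))%:E + (n%:R^-1)%:E :> \bar R)%E.
    by rewrite -EFinD; congr EFin; ring.
  by rewrite leeD2r// oracle_ftest.
- rewrite lee_fin; apply: mulr_ge0; first exact: ltW.
  by apply: mulr_ge0 => //; exact: sqr_ge0.
- by rewrite lee_fin invr_ge0 ltW.
Qed.

(** Makes [2 ^+ level n] of order [sqrt n]: it tends to infinity while its quotient by [n] tends to
    0. *)
Definition level n := (j0 n)./2.

Lemma level_le n : (level n <= j0 n)%N.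
Proof. by rewrite /level; lia. Qed.

Lemma level_pinfty : level @ \oo --> \oo.
Proof.
apply/cvgnyPge => m; exists (2 ^ m.*2)%N => // n /= mn.
rewrite /level -(doubleK m) half_leq// /j0.
by apply: leq_trans (leq_trunc_log 2 mn); rewrite trunc_expnK.
Qed.

Lemma level_sqr_le n : (0 < n)%N -> (2 ^ level n * 2 ^ level n <= n)%N.
Proof.
move=> n0; rewrite -expnD addnn; apply: leq_trans (trunc_logP (isT : 1 < 2)%N n0).
by rewrite leq_exp2l// /level -/(j0 n); lia.
Qed.

Lemma ln_level_le n : (0 < n)%N -> ln n%:R <= 2 * (level n).+1%:R :> R.
Proof.
move=> n0; have n0' : 0 < n%:R :> R by rewrite ltr0n.
have : n%:R <= 2 ^+ (level n).+1.*2 :> R.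
  rewrite -natrX ler_nat; apply: leq_trans (ltnW (trunc_log_ltn n (isT : 1 < 2)%N)) _.
  by rewrite leq_exp2l// /level -/(j0 n); lia.
rewrite -ler_ln ?posrE ?exprn_gt0// => /le_trans; apply.
have ln2 : ln 2 <= 1 :> R by have := @le_ln1Dx R 1; rewrite -[1 + 1]/2; apply; lra.
rewrite lnXn// -[_ *+ _]mulr_natr -muln2 natrM.
have : 0 <= (level n).+1%:R :> R by [].
by move: ((level n).+1%:R) => y; nra.
Qed.

Lemma ln_level_ge n : (0 < n)%N -> 2 * ln 2 * (level n)%:R <= ln n%:R :> R.
Proof.
move=> n0; have p0 : 0 < 2 ^+ level n :> R by rewrite exprn_gt0.
have : 2 ^+ level n * 2 ^+ level n <= n%:R :> R.
  by rewrite -natrX -natrM ler_nat level_sqr_le.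
rewrite -ler_ln ?posrE ?mulr_gt0 ?ltr0n//; apply: le_trans.
by rewrite lnM ?posrE// lnXn// -[_ *+ _]mulr_natr; lra.
Qed.

(** 9 is the first value that works: [4 * 81 > 256] but [4 * 100 <= 512]. *)
Lemma quadratic_le_exp2 J : (9 <= J)%N -> (4 * (J.+1 * J.+1) <= 2 ^ J)%N.
Proof.
elim: J => // J IH; rewrite leq_eqVlt => /predU1P[<- //|]; rewrite ltnS => J9.
by have := IH J9; rewrite expnS; nia.
Qed.

(** Since [2 ^+ J * 2 ^+ J <= n], it suffices to bound [2 * d2 * L] and [L * ln L] by [2 ^+ J]. Both
    are at most [4 * (J + 1) ^+ 2], by [L <= 2 * (J + 1)], [d2 <= J] and [ln L <= L]. *)
Lemma eventually_admissible gamma gm n J (L := ln n%:R : R) :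
  (1 < n)%N -> J = level n -> (9 <= J)%N ->
  (Num.sqrt gamma - Num.sqrt gm) ^+ 2 <= J%:R ->
  ((Num.sqrt gamma - Num.sqrt gm) * Num.sqrt (2 * L / n%:R)) ^+ 2 * 2 ^+ J <= 1 /\
  L * ln L / n%:R <= 2 ^- J.
Proof.
move=> n1 JE J9; set d2 := (_ - _) ^+ 2 => dJ.
have N0 : 0 < n%:R :> R by rewrite ltr0n (ltn_trans _ n1).
have L0 : 0 < L by rewrite ln_gt0// ltr1n.
have LJ : L <= 2 * (J%:R + 1).
  by have := ln_level_le (ltnW n1); rewrite -JE -[J.+1%:R]natr1.
have J0 : 0 <= J%:R :> R by [].
have PP : 2 ^+ J * 2 ^+ J <= n%:R :> R.
  by rewrite -natrX -natrM ler_nat JE level_sqr_le// ltnW.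
have P0 : 0 < 2 ^+ J :> R by rewrite exprn_gt0.
have QP : 4 * ((J%:R + 1) * (J%:R + 1)) <= 2 ^+ J :> R.
  by have := quadratic_le_exp2 J9; rewrite -(ler_nat R) natrX !natrM -[J.+1%:R]natr1.
have d0 : 0 <= d2 by rewrite sqr_ge0.
split.
  rewrite exprMn -/d2 sqr_sqrtr ?divr_ge0 ?mulr_ge0 ?(ltW L0)//.
  rewrite (_ : d2 * (2 * L / n%:R) * 2 ^+ J = d2 * (2 * L) * 2 ^+ J / n%:R); last by ring.
  rewrite ler_pdivrMr// mul1r; apply: le_trans PP; rewrite ler_pM2r//.
  apply: le_trans QP; apply: (@le_trans _ _ (J%:R * (2 * L))).
    by rewrite ler_wpM2r// mulr_ge0// ltW.
  by move: LJ J0; move: (J%:R) => y; nra.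
rewrite ler_pdivrMr// [leRHS]mulrC ler_pdivlMr//; apply: le_trans PP; rewrite ler_pM2r//.
apply: le_trans QP; have := ltW (ln_sublinear L0) => lnL.
apply: (@le_trans _ _ (L * L)); first by rewrite ler_pM2l.
by move: LJ J0 L0; move: (J%:R) => y; nra.
Qed.

(* The factor [1 + eps n] given by [risk_ratio_ftest_ge] at level [level n]. *)
Definition efficiency gamma gm n : R :=
  (1 - (2 / (ln n%:R * gm) + 4 * gamma / gm * (2 ^+ level n / n%:R)))
  * (2 ^+ level n / (2 ^+ level n + 2)).

Lemma cvg_efficiency gamma gm : 0 < gm -> 0 < gamma ->
  (fun n => efficiency gamma gm n - 1) @ \oo --> (0 : R).
Proof.
(* One summand of [C] per error term, each being at most its constant over [(level n).+1]. *)
move=> gm0 gamma0; pose C : R := 2 / (gm * ln 2) + 4 * gamma / gm + 2.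
have ln2 : 0 < ln 2 :> R by rewrite ln_gt0// ltr1n.
have hl : (fun n => (level n).+1%:R^-1 : R) @ \oo --> (0 : R).
  exact: (cvg_comp _ _ level_pinfty (@cvg_harmonic R)).
have hC : (fun n => - C * (level n).+1%:R^-1) @ \oo --> (0 : R).
  by rewrite -(mulr0 (- C)); apply: cvgM => //; exact: cvg_cst.
apply: (squeeze_cvgr _ hC (cvg_cst 0)).
have l1 : \forall n \near \oo, (0 < level n)%N by move/cvgnyPge : level_pinfty; apply.
near=> n; have n0 : (1 < n)%N by near: n; exact: nbhs_infty_gt.
have J1 : (0 < level n)%N by near: n.
have N0 : 0 < n%:R :> R by rewrite ltr0n (ltn_trans _ n0).
have L0 : 0 < ln n%:R :> R by rewrite ln_gt0// ltr1n.
have Lge := ln_level_ge (ltnW n0); rewrite /efficiency; set J := level n in J1 Lge *.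
have P0 : 0 < 2 ^+ J :> R by rewrite exprn_gt0.
have PP : 2 ^+ J * 2 ^+ J <= n%:R :> R.
  by rewrite -natrX -natrM ler_nat level_sqr_le// ltnW.
have PJ : J.+1%:R <= 2 ^+ J :> R by rewrite -natrX ler_nat ltn_expl.
have JJ : J.+1%:R <= 2 * J%:R :> R by rewrite -natrM ler_nat; lia.
have Jp : 0 < J.+1%:R :> R by [].
have q1 : 2 / (ln n%:R * gm) <= 2 / (gm * ln 2) * J.+1%:R^-1.
  rewrite -mulrA ler_wpM2l// -invfM lef_pV2 ?posrE ?mulr_gt0//.
  rewrite [leRHS]mulrC -mulrA ler_wpM2l ?(ltW gm0)//.
  apply: le_trans Lge; rewrite -mulrA mulrCA ler_wpM2l// ltW//.
have q2 : 2 ^+ J / n%:R <= J.+1%:R^-1 :> R.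
  rewrite ler_pdivrMr// [leRHS]mulrC ler_pdivlMr//; apply: le_trans PP.
  by rewrite ler_pM2l.
have q3 : 2 / (2 ^+ J + 2) <= 2 * J.+1%:R^-1 :> R.
  rewrite ler_wpM2l// lef_pV2 ?posrE ?addr_gt0//.
  by apply: le_trans PJ _; rewrite lerDl.
have g4 : 0 <= 4 * gamma / gm by rewrite divr_ge0 ?mulr_ge0// ltW.
have q2' : 4 * gamma / gm * (2 ^+ J / n%:R) <= 4 * gamma / gm * J.+1%:R^-1 by rewrite ler_wpM2l.
have -> : 2 ^+ J / (2 ^+ J + 2) = 1 - 2 / (2 ^+ J + 2) :> R.
  by field; rewrite gt_eqF// addr_gt0.
have z1 : 0 <= 2 / (ln n%:R * gm) by rewrite divr_ge0// mulr_ge0// ltW.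
have z2 : 0 <= 4 * gamma / gm * (2 ^+ J / n%:R) by rewrite mulr_ge0// divr_ge0// ltW.
have z3 : 0 <= 2 / (2 ^+ J + 2) :> R by rewrite divr_ge0// addr_ge0// ltW.
have z4 : 2 / (2 ^+ J + 2) <= 1 :> R by rewrite ler_pdivrMr ?addr_gt0// mul1r lerDr ltW.
have -> : - C * J.+1%:R^-1 = - (2 / (gm * ln 2) * J.+1%:R^-1
    + 4 * gamma / gm * J.+1%:R^-1 + 2 * J.+1%:R^-1) by rewrite /C; ring.
(* The middle term is [- (x + y) * (1 - z) - z], and [1 - z] lies in [0, 1]. *)
have bound (x y z x' y' z' : R) : x <= x' -> y <= y' -> z <= z' ->
    0 <= x -> 0 <= y -> 0 <= z -> z <= 1 ->
    - (x' + y' + z') <= (1 - (x + y)) * (1 - z) - 1 <= 0.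
  by move=> *; apply/andP; split; nra.
exact: bound.
Unshelve. all: by end_near. Qed.

End Asymptotics.

(** * Choice of the sequence and conclusion *)

Unset Implicit Arguments.

Theorem theorem4 (R : realType) (gamma_min gamma R0 : R) :
  1 < gamma_min -> gamma_min < gamma -> 2 <= R0 ->
  exists eps : nat -> R, eps @ \oo --> 0 /\
    forall n : nat, (2 <= n)%N ->
      ((2 * (Num.sqrt gamma - Num.sqrt gamma_min) ^+ 2 * ln n%:R * (1 + eps n))%:E
       <= ereal_sup [set risk_ratio gamma n f | f in Fclass n R0])%E.
Proof.
move=> gm1 gmg R2; have gm0 : 0 < gamma_min by exact: lt_trans gm1.
have gamma0 : 0 < gamma by exact: lt_trans gmg.
pose d2 := (Num.sqrt gamma - Num.sqrt gamma_min) ^+ 2.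
pose large n := (9 <= level n)%N && (d2 <= (level n)%:R).
(* For the remaining [n] the value [-1] makes the bound 0, which the zero intensity attains; these
   [n] are finitely many as [level] tends to infinity. *)
exists (fun n => if large n then efficiency gamma gamma_min n - 1 else -1); split.
  apply: cvg_trans (cvg_efficiency gm0 gamma0).
  apply: near_eq_cvg.
  have h9 : \forall n \near \oo, (9 <= level n)%N by move/cvgnyPge : level_pinfty; apply.
  have hd : \forall n \near \oo, ((Num.truncn d2).+1 <= level n)%N.
    by move/cvgnyPge : level_pinfty; apply.
  near=> n; rewrite /large ifT//; apply/andP; split; first by near: n.
  have hn : ((Num.truncn d2).+1 <= level n)%N by near: n.
  rewrite (le_trans (ltW (truncnS_gt d2)))// ler_nat.
  exact: hn.
move=> n n2; case: ifP => [/andP[l9 ld]|_]; last first.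
  rewrite subrr mulr0.
  apply: le_trans (risk_ratio_ge0 gamma n (fun _ : R => lexx 0)) _.
  by apply: ereal_sup_ubound; exists (fun=> 0) => //; exact: cst0_Fclass.
have [c1 c2] := eventually_admissible n2 erefl l9 ld.
rewrite (addrC 1) subrK; apply: le_trans (risk_ratio_ftest_ge gm0 gmg n2 (level_le n) c1) _.
by apply: ereal_sup_ubound; eexists; [exact: (ftest_Fclass R2 c1 c2)|].
Unshelve. all: by end_near. Qed.
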